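(* Let $M$ be a connected $7$-manifold with a torsion-free $\mathrm{G}_2$-structure $\varphi$ invariant under an effective $\mathbb{T}^3$-action, and suppose the orbits are isotropic. Then $(M,\varphi)$ is locally toric.
   Context: A $\mathrm{G}_2$-structure on a $7$-manifold $M$ is a smooth $3$-form $\varphi$ such that each $T_pM$ has a basis in whose dual basis $\varphi_p=e^{123}-e^1(e^{45}+e^{67})-e^2(e^{46}+e^{75})-e^3(e^{47}+e^{56})$ (wedges omitted). It determines a metric and orientation by $g_\varphi(u,v)\,\mathrm{dvol}_{g_\varphi}=\frac16(u\lrcorner\varphi)\wedge(v\lrcorner\varphi)\wedge\varphi$; $*$ is the Hodge star. It is torsion-free if $d\varphi=0$ and $d{*\varphi}=0$. Orbits are isotropic if $\varphi(U_1,U_2,U_3)=0$ for generating vector fields $U_1,U_2,U_3$ of the action. For an Abelian Lie group $\mathrm{G}$ with Lie algebra $\mathfrak g$ acting on a manifold $M$ and preserving a closed $(k+1)$-form $\sigma$, a multi-moment map for $\sigma$ is an invariant map $\nu:M\to\Lambda^k\mathfrak g^*$ with $d\langle\nu,W\rangle=\xi(W)\lrcorner\sigma$ for all $W\in\Lambda^k\mathfrak g$, where $\xi(W)$ is the multivector field determined by $W$ via the action. A torsion-free $(M,\varphi)$ with an effective $\mathbb{T}^3$-action preserving $\varphi$ is toric if it admits multi-moment maps $\nu:M\to\Lambda^2(\mathfrak t^3)^*\simeq\mathbb{R}^3$ for $\varphi$ and $\mu:M\to\Lambda^3(\mathfrak t^3)^*\simeq\mathbb{R}$ for $*\varphi$.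 It is locally toric if such maps exist on a $\mathbb{T}^3$-invariant open neighbourhood near any point. *)

(* Defs.v *)
(* MathComp-Analysis world. *)
From HB Require Import structures.
From mathcomp Require Import all_boot all_order all_algebra perm.
From mathcomp Require Import all_classical all_reals all_analysis.

Set Implicit Arguments.
Unset Strict Implicit.
Unset Printing Implicit Defensive.

Import Order.TTheory GRing.Theory Num.Theory.
Import numFieldNormedType.Exports.

Local Open Scope classical_set_scope.
Local Open Scope ring_scope.

(** * Alternating multilinear algebra on ['rV[R]_n] *)

Section LinearAlgebra.
Variable R : realType.

Definition fcat {T : Type} {k l : nat} (a : 'I_k -> T) (b : 'I_l -> T)
    (j : 'I_(k + l)) : T :=
  match fintype.split j with inl i => a i | inr i => b i end.

Definition is_altform (k n : nat) (f : ('I_k -> 'rV[R]_n) -> R) : Prop :=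
  (forall (v : 'I_k -> 'rV[R]_n) (j : 'I_k) (c : R) (x y : 'rV[R]_n),
     f [eta v with j |-> c *: x + y]
     = c * f [eta v with j |-> x] + f [eta v with j |-> y]) /\
  (forall (v : 'I_k -> 'rV[R]_n) (i j : 'I_k), i != j -> v i = v j -> f v = 0).

(* Normalised so that e^1 /\ ... /\ e^k is the determinant. *)
Definition wedge (k l n : nat) (f : ('I_k -> 'rV[R]_n) -> R)
    (g : ('I_l -> 'rV[R]_n) -> R) (v : 'I_(k + l) -> 'rV[R]_n) : R :=
  ((k`! * l`!)%N%:R)^-1 *
  \sum_(s : 'S_(k + l)) (-1) ^+ s * f (fun i => v (s (lshift l i)))
                                  * g (fun i => v (s (rshift k i))).

(* u -| f ; the type ['I_k.+1] is convertible to ['I_(1 + k)]. *)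
Definition contract (k n : nat) (u : 'rV[R]_n) (f : ('I_k.+1 -> 'rV[R]_n) -> R)
    (v : 'I_k -> 'rV[R]_n) : R :=
  f (@fcat _ 1 k (fun=> u) v).

Definition posdef (n : nat) (G : 'M[R]_n) : Prop :=
  G^T = G /\ forall v : 'rV[R]_n, v != 0 -> 0 < (v *m G *m v^T) 0 0.

(* Volume form of the inner product with Gram matrix [G], for the standard
   orientation of R^n ([o = false]) or the opposite one ([o = true]). *)
Definition dvol (n : nat) (G : 'M[R]_n) (o : bool)
    (v : 'I_n -> 'rV[R]_n) : R :=
  (-1) ^+ o * Num.sqrt (\det G) * \det (\matrix_(i < n, j < n) v i 0 j).

Definition bvec (n : nat) (a : 'I_n) : 'rV[R]_n := delta_mx 0 a.

(* The index formula: [hodge G o f] has components 1/k! f^{i_1 .. i_k} dvol_{i_1 .. i_k j..},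
   the indices of f being raised with G; it is the operator determined by
   wedge h (hodge G o f) = <h, f> dvol for every k-form h. *)
Definition hodge (k l : nat) (G : 'M[R]_(k + l)) (o : bool)
    (f : ('I_k -> 'rV[R]_(k + l)) -> R) (v : 'I_l -> 'rV[R]_(k + l)) : R :=
  (k`!%:R)^-1 *
  \sum_(I : {ffun 'I_k -> 'I_(k + l)}) \sum_(J : {ffun 'I_k -> 'I_(k + l)})
     (\prod_(i < k) invmx G (I i) (J i)) * f (fun i => bvec (J i))
     * dvol G o (fcat (fun i => bvec (I i)) v).

(** ** G2 linear algebra *)

(* e^{abc} on R^7, with indices running from 1 to 7. *)
Definition e3 (a b c : nat) (v : 'I_3 -> 'rV[R]_7) : R :=
  \det (\matrix_(i < 3, j < 3) v i 0 (inord (nth 0%N [:: a; b; c] j).-1)).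

Definition g2_model (v : 'I_3 -> 'rV[R]_7) : R :=
  e3 1 2 3 v - (e3 1 4 5 v + e3 1 6 7 v) - (e3 2 4 6 v + e3 2 7 5 v)
             - (e3 3 4 7 v + e3 3 5 6 v).

(* The rows of [E] are the adapted basis, so [v *m invmx E] lists the values of
   the dual basis on v. *)
Definition g2_form (f : ('I_3 -> 'rV[R]_7) -> R) : Prop :=
  exists2 E : 'M[R]_7, E \in unitmx &
    forall v, f v = g2_model (fun i => v i *m invmx E).

Definition is_g2_metric (f : ('I_3 -> 'rV[R]_7) -> R)
    (Go : 'M[R]_7 * bool) : Prop :=
  posdef Go.1 /\
  forall (u v : 'rV[R]_7) (w : 'I_7 -> 'rV[R]_7),
    (u *m Go.1 *m v^T) 0 0 * dvol Go.1 Go.2 w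
    = 6^-1 * wedge (wedge (contract u f) (contract v f)) f w.

(* For a G2-form exactly one pair (metric, orientation) satisfies
   [is_g2_metric]; the default value is irrelevant. *)
Definition g2_metric (f : ('I_3 -> 'rV[R]_7) -> R) : 'M[R]_7 * bool :=
  xget (1%:M, false) [set Go | is_g2_metric f Go].

Definition g2_star (f : ('I_3 -> 'rV[R]_7) -> R) :
    ('I_4 -> 'rV[R]_7) -> R :=
  @hodge 3 4 (g2_metric f).1 (g2_metric f).2 f.

End LinearAlgebra.

(** * Smooth maps and manifolds *)

(* [C^k] on an open subset of a finite-dimensional space. *)
Fixpoint Ck (R : realType) (V W : normedModType R) (k : nat) (A : set V)
    (f : V -> W) : Prop :=
  match k with
  | 0 => forall x, A x -> {for x, continuous f}
  | k'.+1 => (forall x, A x -> differentiable f x) /\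
             (forall v : V, Ck k' A (fun x => 'D_v f x))
  end.

Definition smooth_on (R : realType) (V W : normedModType R) (A : set V)
    (f : V -> W) : Prop := forall k, Ck k A f.

(* [coord c] and [param c] are meaningful on [dom c] and on its image only. *)
Record manifold (R : realType) (n : nat) := Manifold {
  mspace :> topologicalType;
  mspace_hausdorff : hausdorff_space mspace;
  mspace_second_countable : @second_countable mspace;
  chart : Type;
  dom : chart -> set mspace;
  coord : chart -> mspace -> 'rV[R]_n;
  param : chart -> 'rV[R]_n -> mspace;
  dom_cover : forall p, exists c, dom c p;
  dom_open : forall c, open (dom c);
  img_open : forall c, open (coord c @` dom c);
  coordK : forall c p, dom c p -> param c (coord c p) = p;
  coord_continuous : forall c p, dom c p -> {for p, continuous (coord c)};
  param_continuous : forall c x, (coord c @` dom c) x ->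
    {for x, continuous (param c)};
  transition_smooth : forall c c',
    smooth_on (coord c @` (dom c `&` dom c')) (coord c' \o param c)
}.

Section Geometry.
Variables (R : realType) (n : nat) (M : manifold R n).

Definition smooth_fun_on (O : set M) (f : M -> R) : Prop :=
  forall c : chart M, smooth_on (coord c @` (dom c `&` O)) (f \o param c).

(* Tangent vectors at p are represented in each chart c at p by their
   components in 'rV[R]_n; these transform by the differential of the
   transition maps.  [omega c p] is the k-form omega_p read in the chart c; its
   value is irrelevant unless p lies in [dom c]. *)
Definition preform (k : nat) := chart M -> M -> ('I_k -> 'rV[R]_n) -> R.

Definition is_form (k : nat) (omega : preform k) : Prop :=
  [/\ forall c p, dom c p -> is_altform (omega c p),
      forall c c' p v, dom c p -> dom c' p ->
        omega c p v =
        omega c' p (fun i => 'D_(v i) (coord c' \o param c) (coord c p)) &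
      forall c v, smooth_on (coord c @` dom c)
                            (fun x => omega c (param c x) v)].

(* The v_i are extended to constant vector fields in the chart c, whose
   brackets vanish. *)
Definition ext_d (k : nat) (omega : preform k) : preform k.+1 :=
  fun c p v =>
    \sum_(j < k.+1) (-1) ^+ j *
      'D_(v j) (fun x => omega c (param c x) (fun i => v (lift j i)))
               (coord c p).

Definition closed_form (k : nat) (omega : preform k) : Prop :=
  forall c p v, dom c p -> ext_d omega c p v = 0.

(** ** Torus actions *)

Definition integral_vector (m : nat) (t : 'rV[R]_m) : Prop :=
  forall j, t 0 j \is a Num.int.

(* T^m is R^m / Z^m, with Lie algebra R^m and exponential map the projection.
   A map out of the quotient is given by a Z^m-periodic map out of R^m, and it
   is smooth iff the latter is. *)
Record torus_action (m : nat) := TorusAction {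
  act :> 'rV[R]_m -> M -> M;
  act_periodic : forall z p, integral_vector z -> act z p = p;
  actD : forall s t p, act (s + t) p = act s (act t p);
  act_continuous : continuous (fun tp : 'rV[R]_m * M => act tp.1 tp.2);
  act_smooth : forall c c' : chart M,
    smooth_on
      [set tx : 'rV[R]_m * 'rV[R]_n |
         (coord c @` dom c) tx.2 /\ dom c' (act tx.1 (param c tx.2))]
      (fun tx : 'rV[R]_m * 'rV[R]_n => coord c' (act tx.1 (param c tx.2)))
}.

Section Actions.
Variables (m : nat) (a : torus_action m).

Definition effective : Prop :=
  forall t, (forall p, a t p = p) -> integral_vector t.

Definition invariant_set (O : set M) : Prop :=
  forall t p, O p -> O (a t p).

Definition invariant_form (k : nat) (omega : preform k) : Prop :=
  forall t c c' p v, dom c p -> dom c' (a t p) ->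
    omega c' (a t p)
      (fun i => 'D_(v i) (fun x => coord c' (a t (param c x))) (coord c p))
    = omega c p v.

(* The generating vector field of w in the Lie algebra R^m, in the chart c. *)
Definition gen_field (w : 'rV[R]_m) (c : chart M) (p : M) : 'rV[R]_n :=
  'D_w (fun t => coord c (a t p)) 0.

(* An element of Lambda^k(R^m)^* is an alternating k-form on R^m, and the list
   W stands for the sum of w_1 /\ ... /\ w_k over its members w; every element
   of Lambda^k(R^m) is of this form when k > 0.  Contraction with a
   decomposable multivector is
   (X_1 /\ ... /\ X_k) -| sigma = sigma (X_1, ..., X_k, . ). *)
Definition multi_moment_map (k : nat) (sigma : preform (k + 1)%N) (O : set M)
    (nu : M -> ('I_k -> 'rV[R]_m) -> R) : Prop :=
  [/\ forall p, O p -> is_altform (nu p),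
      forall t p, O p -> nu (a t p) = nu p,
      forall w, smooth_fun_on O (fun p => nu p w) &
      forall (W : seq ('I_k -> 'rV[R]_m)) (c : chart M) (p : M)
             (v : 'rV[R]_n), O p -> dom c p ->
        'D_v (fun x => \sum_(w <- W) nu (param c x) w) (coord c p)
        = \sum_(w <- W)
            sigma c p (fcat (fun i => gen_field (w i) c p) (fun=> v))].

End Actions.
End Geometry.

(** * Torsion-free G2-manifolds with a torus action *)

Section G2.
Variables (R : realType) (M : manifold R 7).
Implicit Types phi : preform M 3.

Definition g2_structure phi : Prop :=
  is_form phi /\ forall c p, dom c p -> g2_form (phi c p).

Definition star phi : preform M 4 := fun c p => g2_star (phi c p).

Definition torsion_free phi : Prop :=
  closed_form phi /\ closed_form (star phi).

Definition isotropic_orbits phi (a : torus_action M 3) : Prop :=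
  forall c p, dom c p ->
    phi c p (fun i : 'I_3 => gen_field a (bvec R i) c p) = 0.

Definition has_multi_moment_maps_on phi (a : torus_action M 3)
    (O : set M) : Prop :=
  (exists nu, multi_moment_map a (k := 2) phi O nu) /\
  (exists mu, multi_moment_map a (k := 3) (star phi) O mu).

Definition locally_toric phi (a : torus_action M 3) : Prop :=
  forall p : M, exists O : set M,
    [/\ open O, O p, invariant_set a O & has_multi_moment_maps_on phi a O].

End G2.

(* Main.v *)
(** The form [star phi] depends smoothly on [phi] and is natural under linear
    isomorphisms, hence is a smooth form, invariant like [phi].  Contracting a closed
    invariant form with a generating field yields a closed invariant form by
    Cartan's formula, so the contractions of [phi] with two and of [star phi] with
    three generating fields are closed invariant 1-forms.  They vanish on the
    generating fields: by isotropy for [phi], and because four vectors of a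
    3-dimensional space are dependent for [star phi].  Such a 1-form has a
    primitive f on a coordinate ball around p.  Let x and t.x be near p.  If t is
    close to the stabiliser of p then f(t.x) = f(x), because f(s.y) - f(y) has
    vanishing differential in (s, y) and vanishes when s fixes y = p; compactness
    of the torus excludes all other t.  Hence f descends to an invariant primitive
    on the saturation of a small neighbourhood of p. *)
From HB Require Import structures.
Require Import Defs.
From mathcomp Require Import all_boot all_order all_algebra perm.
From mathcomp Require Import all_classical all_reals all_analysis.
From mathcomp Require Import ring lra.
Import Defs.
Set Implicit Arguments.
Unset Strict Implicit.
Unset Printing Implicit Defensive.
Import Order.TTheory GRing.Theory Num.Theory.
Import numFieldNormedType.Exports.
Local Open Scope classical_set_scope.
Local Open Scope ring_scope.

(** * Calculus in normed modules *)

(** Stabilisers may be nontrivial, so the orbit space near a point can be singular. No slice is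
    constructed: invariance of a primitive is a statement about pairs of points (q, t.q), proved
    uniformly in t on a compact set of representatives. The multivectors w are treated as one
    family. Infinitely many w have to share one saturated neighbourhood, which works because the
    neighbourhoods come from the chart and the action alone. Normalising every primitive to vanish
    at the centre of the ball makes the family alternating in w. The other obstacle is the star:
    [g2_metric] is a choice, with no evident regularity or naturality. What depends polynomially on
    the form is the right-hand side of the metric equation, the matrix B = s g with s the signed
    volume factor. Since \det B = s ^ 9, the factor s can be eliminated, and the star becomes an
    explicit function of B and the form. Invertibility of B and existence of a metric reduce by
    pull-back to the model form, where B is the identity by a finite computation with integers. *)

Lemma derive_comp (R : numFieldType) (U V W : normedModType R) (f : U -> V)
    (g : V -> W) (x v : U) :
  differentiable f x -> differentiable g (f x) ->
  'D_v (g \o f) x = 'D_('D_v f x) g (f x).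
Proof.
move=> df dg; rewrite deriveE; last exact: differentiable_comp.
by rewrite diff_comp // deriveE // deriveE.
Qed.

Lemma derive_dirP (R : numFieldType) (V W : normedModType R) (f : V -> W)
    (x u v : V) (c : R) : differentiable f x ->
  'D_(c *: u + v) f x = c *: 'D_u f x + 'D_v f x.
Proof. by move=> df; rewrite !deriveE // linearP. Qed.

Lemma derive_dirZ (R : numFieldType) (V W : normedModType R) (f : V -> W)
    (x v : V) (c : R) : differentiable f x -> 'D_(c *: v) f x = c *: 'D_v f x.
Proof. by move=> df; rewrite !deriveE // linearZ. Qed.

Lemma is_derive_line (R : numFieldType) (V W : normedModType R) (f : V -> W)
    (x v : V) (s : R) : derivable f (s *: v + x) v ->
  is_derive s 1 (fun t : R => f (t *: v + x)) ('D_v f (s *: v + x)).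
Proof.
move=> df.
have E : (fun h : R => h^-1 *: (((fun t : R => f (t *: v + x)) \o shift s)
              (h *: (1 : R)) - f (s *: v + x))) =
         (fun h : R => h^-1 *: ((f \o shift (s *: v + x)) (h *: v)
              - f (s *: v + x))).
  apply/funext => h /=.
  by rewrite [h *: (1 : R)]mulr1 scalerDl addrA.
split; first by rewrite /derivable E.
by rewrite /derive E.
Qed.

Lemma differentiable_eps (R : numFieldType) (V W : normedModType R) (f : V -> W)
    (x : V) (L : {linear V -> W}) : continuous L ->
  (forall e : R, 0 < e -> \forall h \near (0 : V),
     `|f (h + x) - f x - L h| <= e * `|h|) ->
  differentiable f x.
Proof.
move=> cL H.
have dxf : f \o shift x = cst (f x) + L +o_ (0 : V) id.
  apply/eqaddoP => e e0; apply: filterS (H e e0) => h /=.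
  by rewrite /cst /= -addrA -opprD.
apply/diff_locallyP; rewrite (diff_unique cL dxf); split => //.
Qed.

Lemma near_eq_differentiable (R : numFieldType) (V W : normedModType R)
    (f g : V -> W) (x : V) : {near x, f =1 g} ->
  differentiable f x -> differentiable g x.
Proof.
move=> fg df; have [df1 df2] := (@diff_locallyP _ _ _ x f).1 df.
apply: (differentiable_eps df1) => e e0.
have fgx : f x = g x by exact: nbhs_singleton fg.
have /eqaddoP/(_ e e0) H := df2.
have N : \forall h \near (0 : V), f (h + x) = g (h + x).
  have : \forall y \near x, f y = g y by [].
  by rewrite (near_shift 0 x) subr0.
apply: filterS2 N H => h E /=.
by rewrite -E -fgx -addrA -opprD.
Qed.

Lemma MVT_line (R : realType) (V : normedModType R) (f : V -> R) (x v : V) :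
  (forall s : R, 0 <= s <= 1 -> derivable f (s *: v + x) v) ->
  exists2 s : R, 0 <= s <= 1 & f (v + x) - f x = 'D_v f (s *: v + x).
Proof.
move=> df.
have D (s : R) : 0 <= s <= 1 ->
    is_derive s 1 (fun t : R => f (t *: v + x)) ('D_v f (s *: v + x)).
  by move=> /df; exact: is_derive_line.
have [||s s01 E] := @MVT_segment R (fun t : R => f (t *: v + x))
    (fun s => 'D_v f (s *: v + x)) 0 1 ler01.
- by move=> s; rewrite in_itv /= => /andP[s0 s1]; apply: D; rewrite !ltW.
- apply: continuous_in_subspaceT => s; rewrite inE /= in_itv /= => /D [].
  by move=> /derivable1_diffP /differentiable_continuous.
- exists s; first by move: s01; rewrite in_itv.
  by move: E; rewrite scale1r scale0r add0r subr0 mulr1.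
Qed.

Lemma derive0_segment_eq (R : realType) (V : normedModType R) (f : V -> R)
    (x y : V) :
  (forall s : R, 0 <= s <= 1 -> is_derive (s *: (y - x) + x) (y - x) f 0) ->
  f x = f y.
Proof.
move=> H; have [s /H []//|s /H [_ Es]] := @MVT_line R V f x (y - x).
by rewrite subrK Es => /eqP; rewrite subr_eq0 => /eqP.
Qed.

(** The mean value theorem on the segment from x to x + h writes the increment as [L y h] with y on
    the segment. The remainder is then a combination of the n differences of [L] on the basis
    vectors, which are small by continuity. *)
Lemma differentiable_rV (R : realType) n (f : 'rV[R]_n -> R) (x : 'rV[R]_n)
    (L : 'rV[R]_n -> 'rV[R]_n -> R) :
  (\forall y \near x, forall v, is_derive y v f (L y v)) ->
  (forall y v, L y v = \sum_(i < n) v 0 i * L y (delta_mx 0 i)) ->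
  (forall i : 'I_n, {for x, continuous (L ^~ (delta_mx 0 i))}) ->
  differentiable f x.
Proof.
move=> nd Ll Lc.
have Llin : linear (L x).
  move=> c u v; rewrite Ll (Ll x u) (Ll x v) scaler_sumr -big_split /=.
  by apply: eq_bigr => i _; rewrite !mxE mulrDl -mulrA.
pose LL := GRing.isLinear.Build R 'rV[R]_n R _ (L x) Llin.
pose Lx : {linear 'rV[R]_n -> R} := HB.pack (L x) LL.
have Lxc : continuous Lx.
  have -> : Lx = (fun v => \sum_(i < n) v 0 i * L x (delta_mx 0 i)) :> (_ -> _).
    by apply/funext => v; rewrite /= Ll.
  move=> v; apply: (@differentiable_continuous _ _ _ v).
  rewrite (_ : (fun _ => _) =
      \sum_(i < n) (fun v : 'rV[R]_n => v 0 i * L x (delta_mx 0 i))).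
    2: by apply/funext => w; rewrite fct_sumE.
  apply: differentiable_sum => i.
  apply: differentiableM => //; exact: differentiable_coord.
apply: (differentiable_eps Lxc) => e e0.
(* The n coordinate terms add up to at most e; the + 1 keeps the divisor positive when n = 0. *)
have e1 : 0 < e / (n%:R + 1) by rewrite divr_gt0 // ltr_wpDl // ler0n.
have nL : \forall y \near x, forall i : 'I_n,
    `|L y (delta_mx 0 i) - L x (delta_mx 0 i)| <= e / (n%:R + 1).
  apply: (@filter_forall _ _ _ (nbhs x)) => i.
  by have /cvgrPdist_le/(_ _ e1) := Lc i; apply: filterS => y; rewrite distrC.
have [d /= d0 dB] := (nbhs_ballP _ _).1 (filterI nd nL).
apply/nbhs_ballP; exists d => //= h; rewrite -ball_normE /ball_/= sub0r normrN.
move=> hd.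
have inB (s : R) : 0 <= s <= 1 -> ball x d (s *: h + x).
  move=> /andP[s0 s1]; rewrite -ball_normE /ball_/= opprD addrC subrK normrN.
  by rewrite normrZ ger0_norm // (le_lt_trans _ hd) // ler_piMl.
have [s s01|s /inB s01 ->] := @MVT_line R _ f x h.
  by have [/(_ h)[]] := dB _ (inB s s01).
have [/(_ h) [_ ->] dL] := dB _ s01.
rewrite /= Ll (Ll x) -sumrB (le_trans (ler_norm_sum _ _ _))//.
apply: (@le_trans _ _ (\sum_(i < n) `|h| * (e / (n%:R + 1)))).
  apply: ler_sum => i _; rewrite -mulrBr normrM ler_pM //.
  by rewrite -[leRHS]/(Num.Def.normr h) [leRHS]/Num.Def.normr /= mx_normrE
     (le_bigmax _ (fun ij => `|h ij.1 ij.2|) (0, i)).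
rewrite [leLHS](_ : _ = n%:R * (`|h| * (e / (n%:R + 1)))); last first.
  by rewrite sumr_const card_ord mulr_natl.
rewrite mulrCA mulrC ler_wpM2r //.
by rewrite mulrCA ger_pMr // ler_pdivrMr ?mul1r ?lerDl // ltr_wpDl // ler0n.
Unshelve. all: by end_near. Qed.

(** * Closure properties of C^k functions *)

Section CkTheory.
Variables (R : realType) (V : normedModType R).
Implicit Types (A B : set V) (k : nat).

Lemma Ck_sub (W : normedModType R) k A B (f : V -> W) :
  B `<=` A -> Ck k A f -> Ck k B f.
Proof.
elim: k f => [|k IH] f BA /=; first by move=> cf x /BA; exact: cf.
by move=> [df Df]; split=> [x /BA /df //|v]; apply: IH.
Qed.

Lemma CkS (W : normedModType R) k A (f : V -> W) : Ck k.+1 A f -> Ck k A f.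
Proof.
elim: k f => [|k IH] f [df Df].
  by move=> x Ax; apply: differentiable_continuous; exact: df.
by split=> // v; apply: IH.
Qed.

(** On an open set equality of values is equality of germs, so all derivatives agree too. The
    closure lemmas use this to replace the derivative of a compound function by its explicit
    formula. *)
Lemma eq_Ck (W : normedModType R) k A (f g : V -> W) : open A ->
  (forall x, A x -> f x = g x) -> Ck k A f -> Ck k A g.
Proof.
move=> oA; elim: k f g => [|k IH] f g fg /=.
  move=> cf x Ax.
  have N : {near x, f =1 g}.
    by have := oA; rewrite openE => /(_ _ Ax); apply: filterS => y /fg.
  have := cf x Ax; rewrite /prop_for /continuous_at -(fg _ Ax).
  by apply: cvg_trans; apply: near_eq_cvg; apply: filterS N => y.
have N x : A x -> {near x, f =1 g}.
  by move=> Ax; have := oA; rewrite openE => /(_ _ Ax); apply: filterS => y /fg.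
move=> [df Df]; split=> [x Ax|v].
  by apply: near_eq_differentiable (N _ Ax) _; exact: df.
by apply: IH (Df v) => x Ax; apply: near_eq_derive; exact: N.
Qed.

Lemma Ck_cst (W : normedModType R) k A (c : W) : Ck k A (fun=> c).
Proof.
elim: k c => [|k IH] c /=; first by move=> x _; exact: cst_continuous.
split=> [x _|v]; first exact: differentiable_cst.
have -> : (fun x : V => 'D_v (fun=> c) x) = (fun=> 0).
  by apply/funext => x; exact: derive_cst.
exact: IH.
Qed.

Lemma CkD (W : normedModType R) k A (f g : V -> W) : open A ->
  Ck k A f -> Ck k A g -> Ck k A (fun x => f x + g x).
Proof.
move=> oA; elim: k f g => [|k IH] f g /=.
  by move=> cf cg x Ax; apply: continuousD; [exact: cf|exact: cg].
move=> [df Df] [dg Dg]; split=> [x Ax|v].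
  by apply: differentiableD; [exact: df|exact: dg].
apply: eq_Ck (IH _ _ (Df v) (Dg v)) => // x Ax.
by rewrite -deriveD; [|exact/diff_derivable/df|exact/diff_derivable/dg].
Qed.

Lemma CkM k A (f g : V -> R) : open A ->
  Ck k A f -> Ck k A g -> Ck k A (fun x => f x * g x).
Proof.
move=> oA; elim: k f g => [|k IH] f g /=.
  by move=> cf cg x Ax; apply: continuousM; [exact: cf|exact: cg].
move=> cf cg; have [[df Df] [dg Dg]] := (cf, cg); split=> [x Ax|v].
  by apply: differentiableM; [exact: df|exact: dg].
have cf' := CkS cf; have cg' := CkS cg.
apply: eq_Ck (CkD oA (IH _ _ cf' (Dg v)) (IH _ _ cg' (Df v))) => // x Ax.
have := @deriveM _ _ f g x v (diff_derivable (df _ Ax)) (diff_derivable (dg _ Ax)).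
by move=> /esym; apply.
Qed.

Lemma CkN k A (f : V -> R) : open A -> Ck k A f -> Ck k A (fun x => - f x).
Proof.
move=> oA cf; apply: eq_Ck (CkM oA (Ck_cst k A (-1 : R)) cf) => // x _.
by rewrite mulN1r.
Qed.

Lemma Ck_sum (I : Type) (r : seq I) (P : pred I) (W : normedModType R) k A
    (F : I -> V -> W) : open A ->
  (forall i, Ck k A (F i)) -> Ck k A (fun x => \sum_(i <- r | P i) F i x).
Proof.
move=> oA cF; elim: r => [|i r IH].
  by apply: eq_Ck (Ck_cst k A 0) => // x _; rewrite big_nil.
case Pi: (P i); last by apply: eq_Ck IH => // x _; rewrite big_cons Pi.
by apply: eq_Ck (CkD oA (cF i) IH) => // x _; rewrite big_cons Pi.
Qed.

Lemma Ck_prod (I : Type) (r : seq I) (P : pred I) k A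
    (F : I -> V -> R) : open A ->
  (forall i, Ck k A (F i)) -> Ck k A (fun x => \prod_(i <- r | P i) F i x).
Proof.
move=> oA cF; elim: r => [|i r IH].
  by apply: eq_Ck (Ck_cst k A (1 : R)) => // x _; rewrite big_nil.
case Pi: (P i); last by apply: eq_Ck IH => // x _; rewrite big_cons Pi.
by apply: eq_Ck (CkM oA (cF i) IH) => // x _; rewrite big_cons Pi.
Qed.

Lemma CkV k A (f : V -> R) : open A -> (forall x, A x -> f x != 0) ->
  Ck k A f -> Ck k A (fun x => (f x)^-1).
Proof.
move=> oA f0; elim: k => [|k IH] /=.
  by move=> cf x Ax; apply: continuousV; [exact: f0|exact: cf].
move=> cf; have [df Df] := cf; split=> [x Ax|v].
  by apply: differentiableV; [exact: df|exact: f0].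
have cV := IH (CkS cf).
apply: eq_Ck (CkM oA (CkN oA (CkM oA cV cV)) (Df v)) => // x Ax.
rewrite deriveV ?f0//; last exact/diff_derivable/df.
by rewrite expr2 invfM.
Qed.

(** The induction is on k for all exponents at once, because differentiation replaces a by a - 1. *)
Lemma Ck_powR k A (f : V -> R) (a : R) : open A -> (forall x, A x -> 0 < f x) ->
  Ck k A f -> Ck k A (fun x => f x `^ a).
Proof.
move=> oA f0.
have dp (x b : R) : 0 < x -> differentiable (fun y => y `^ b) x.
  by move=> /(is_derive1_powR b)[/derivable1_diffP].
elim: k a => [|k IH] a /=.
  move=> cf x Ax; apply: (@continuous_comp _ _ _ f (fun y => y `^ a)).
    exact: cf.
  by apply: differentiable_continuous; apply: dp; exact: f0.
move=> cf; have [df Df] := cf; split=> [x Ax|v].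
  apply: (@differentiable_comp _ _ _ _ f (fun y => y `^ a)); first exact: df.
  by apply: dp; exact: f0.
apply: eq_Ck (CkM oA (CkM oA (Ck_cst k A a) (IH (a - 1) (CkS cf))) (Df v)) => //.
move=> x Ax; have fx := dp _ a (f0 _ Ax).
have E (w : R) : 'D_w (fun y => y `^ a) (f x) = w * (a * f x `^ (a - 1)).
  have -> : w = w *: (1 : R) by rewrite [RHS]mulr1.
  by rewrite derive_dirZ // [w *: 1]mulr1; have [_ ->] := is_derive1_powR a (f0 _ Ax).
have := @derive_comp _ _ _ _ f (fun y => y `^ a) x v (df _ Ax) fx.
by rewrite E mulrC => <-.
Qed.

End CkTheory.

Section CkSlice.
Variables (R : realType) (U V W : normedModType R).

Lemma Ck_slice k (A : set (U * V)) (F : U * V -> W) (t : U) :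
  open A -> Ck k A F -> Ck k [set x | A (t, x)] (fun x => F (t, x)).
Proof.
move=> oA.
have dt (x : V) : is_diff x (fun y : V => (t, y)) (fun v => (0, v)).
  by have := is_diff_pair (is_diff_cst t x) (is_diff_id x).
have oS : open [set x | A (t, x)].
  apply: (@open_comp _ _ (fun y : V => (t, y)) A) => // x _.
  by apply: differentiable_continuous; case: (dt x).
elim: k F => [|k IH] F /=.
  move=> cF x Ax; apply: (@continuous_comp _ _ _ (fun y : V => (t, y)) F).
    by apply: differentiable_continuous; case: (dt x).
  exact: cF.
move=> [dF DF]; split=> [x Ax|v].
  apply: (@differentiable_comp _ _ _ _ (fun y : V => (t, y)) F).
    by case: (dt x).
  exact: dF.
have H := IH _ (DF (0, v)).
refine (@eq_Ck R V W k _ _ _ oS _ H).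
move=> x Ax; have [d1 d2] := dt x.
have -> := @derive_comp _ _ _ _ (fun y : V => (t, y)) F x v d1 (dF _ Ax).
by rewrite (deriveE _ d1) d2.
Qed.

End CkSlice.

Lemma Ck_coord (R : realType) (V : normedModType R) n k (A : set V)
    (F : V -> 'rV[R]_n) (i : 'I_n) :
  open A -> Ck k A F -> Ck k A (fun x => F x 0 i).
Proof.
move=> oA; elim: k F => [|k IH] F /=.
  move=> cF x Ax; apply: (@continuous_comp _ _ _ F (fun y : 'rV[R]_n => y 0 i)).
    exact: cF.
  exact/differentiable_continuous/differentiable_coord.
move=> [dF DF]; split=> [x Ax|v].
  apply: (@differentiable_comp _ _ _ _ F (fun y : 'rV[R]_n => y 0 i)).
    exact: dF.
  exact: differentiable_coord.
apply: eq_Ck (IH _ (DF v)) => // x Ax.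
by rewrite derive_mx ?mxE//; exact/diff_derivable/dF.
Qed.

Lemma derive_coord (R : realType) (V : normedModType R) n
    (F : V -> 'rV[R]_n) (x v : V) (i : 'I_n) :
  derivable F x v -> 'D_v (fun x => F x 0 i) x = ('D_v F x) 0 i.
Proof. by move=> dF; rewrite derive_mx // mxE. Qed.

(** * Symmetry of second derivatives *)

Section Schwarz.
Variables (R : realType) (V : normedModType R).

Lemma is_derive_addl (W : normedModType R) (f : V -> W) (x v u : V) :
  derivable f (v + x) u -> is_derive x u (fun y => f (v + y)) ('D_u f (v + x)).
Proof.
move=> df.
have E : (fun h : R => h^-1 *: (((fun y => f (v + y)) \o shift x) (h *: u)
              - f (v + x))) =
         (fun h : R => h^-1 *: ((f \o shift (v + x)) (h *: u) - f (v + x))).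
  by apply/funext => h /=; rewrite addrCA.
by split; [rewrite /derivable E|rewrite /derive E].
Qed.

(** Two uses of the mean value theorem: along u for y |-> f (v + y) - f y, then along v for the
    derivative of f in the direction u. *)
Lemma second_difference (f : V -> R) (x u v : V) :
  (forall s t : R, 0 <= s <= 1 -> 0 <= t <= 1 ->
     differentiable f (t *: v + (s *: u + x)) /\
     differentiable ('D_u f) (t *: v + (s *: u + x))) ->
  exists s t : R, [/\ 0 <= s <= 1, 0 <= t <= 1 &
    f (v + (u + x)) - f (u + x) - (f (v + x) - f x) =
    'D_v ('D_u f) (t *: v + (s *: u + x))].
Proof.
move=> df.
have i0 : 0 <= (0 : R) <= 1 by rewrite lexx ler01.
have i1 : 0 <= (1 : R) <= 1 by rewrite lexx ler01.
have dG s : 0 <= s <= 1 -> is_derive (s *: u + x) u (fun y => f (v + y) - f y)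
    ('D_u f (v + (s *: u + x)) - 'D_u f (s *: u + x)).
  move=> s01; apply: is_deriveB.
    apply: is_derive_addl; apply: diff_derivable.
    by have [] := df s 1 s01 i1; rewrite scale1r.
  apply/derivableP/diff_derivable.
  by have [] := df s 0 s01 i0; rewrite scale0r add0r.
have [s /dG []//|s s01 Es] := @MVT_line R V (fun y => f (v + y) - f y) x u.
have [t t01|t t01 Et] := @MVT_line R V ('D_u f) (s *: u + x) v.
  by apply: diff_derivable; have [] := df s t s01 t01.
exists s, t; split => //; rewrite Es -Et.
by have [_ ->] := dG s s01.
Qed.

(** The values compared are taken at different points y and z, as the mean value theorem provides
    them. *)
Lemma continuous_eq_near (f g : V -> R) (x : V) :
  {for x, continuous f} -> {for x, continuous g} ->
  (forall d : R, 0 < d -> exists y z, [/\ ball x d y, ball x d z & f y = g z]) ->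
  f x = g x.
Proof.
move=> cf cg H; apply/eqP; rewrite -subr_eq0 -normr_le0.
apply/ler_addgt0Pl => e e0; rewrite addr0.
have e2 : 0 < e / 2 by rewrite divr_gt0.
have /cvgrPdist_le/(_ _ e2) N1 := cf.
have /cvgrPdist_le/(_ _ e2) N2 := cg.
have [d /= d0 dB] := (nbhs_ballP _ _).1 (filterI N1 N2).
have [y [z [/dB [fy _] /dB [_ gz] yz]]] := H d d0.
rewrite (splitr e) (le_trans (ler_distD (f y) (f x) (g x))) // lerD //.
by rewrite yz distrC.
Qed.

(** The second difference over a parallelogram is symmetric in its two sides. Evaluating it in both
    orders gives equal mixed derivatives at two points of an arbitrarily small parallelogram, and
    continuity moves both points to x. *)
Lemma Schwarz (f : V -> R) (A : set V) (x u v : V) : open A -> Ck 2 A f ->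
  A x -> 'D_u ('D_v f) x = 'D_v ('D_u f) x.
Proof.
have G (p q r z : R) : p - q - (r - z) = p - r - (q - z) by ring.
move=> oA [df Df] Ax.
have [_ Cuv] := Df v; have [_ Cvu] := Df u.
apply: (continuous_eq_near (Cuv u x Ax) (Cvu v x Ax)) => d' d'0.
have nA : nbhs x A by have := oA; rewrite openE; apply.
have [d /= d0 dB] := (nbhs_ballP _ _).1 (filterI nA (nbhsx_ballx x d' d'0)).
(* The parallelogram spanned by h u and h v stays in the ball; the + 1 in the divisor covers u = v =
   0. *)
have [h h0 hd] : exists2 h : R, 0 < h & h * (`|v| + `|u|) < d.
  have n0 : 0 < `|v| + `|u| + 1 by rewrite ltr_wpDl // addr_ge0.
  exists (d / (`|v| + `|u| + 1)); first by rewrite divr_gt0.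
  by rewrite -mulrA gtr_pMr // mulrC ltr_pdivrMr // mul1r ltrDl.
have inB (s t : R) : 0 <= s <= 1 -> 0 <= t <= 1 ->
    ball x d (t *: (h *: v) + (s *: (h *: u) + x)).
  move=> /andP[s0 s1] /andP[t0 t1].
  rewrite -ball_normE /ball_/= addrA opprD addrCA subrr addr0 normrN.
  apply: (le_lt_trans (ler_normD _ _)).
  rewrite !normrZ (gtr0_norm h0) !ger0_norm //.
  apply: (@le_lt_trans _ _ (h * `|v| + h * `|u|)).
    by rewrite lerD // ler_piMl // mulr_ge0 // ltW.
  by rewrite -mulrDr.
(* Both expressions of the second difference carry the same factor h ^ 2, which cancels at the
   end. *)
have DZ (w w' y : V) : A y -> 'D_(h *: w) ('D_(h *: w') f) y =
    h * (h * 'D_w ('D_w' f) y).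
  move=> Ay.
  have nAy : nbhs y A by have := oA; rewrite openE; apply.
  have N : \near y, 'D_(h *: w') f y = h *: 'D_w' f y.
    by apply: filterS nAy => z Az; rewrite derive_dirZ //; exact: df.
  have [dw _] := Df w'.
  rewrite (near_eq_derive _ N) derive_dirZ //.
    by rewrite -[fun z => _]/(h \*: 'D_w' f) deriveZ //; exact/diff_derivable/dw.
  by apply: differentiableZ; exact: dw.
have dZ (w y : V) : A y -> differentiable ('D_(h *: w) f) y.
  move=> Ay; have nAy : nbhs y A by have := oA; rewrite openE; apply.
  have [dw _] := Df w.
  apply: (@near_eq_differentiable _ _ _ (h \*: 'D_w f)).
    by apply: filterS nAy => z Az; rewrite derive_dirZ //; exact: df.
  by apply: differentiableZ; exact: dw.
have [s t s01 t01|s [t [s01 t01 E1]]] := @second_difference f x (h *: u) (h *: v).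
  by have [Ay _] := dB _ (inB s t s01 t01); split; [exact: df|exact: dZ].
have inB' (a b : R) : 0 <= a <= 1 -> 0 <= b <= 1 ->
    ball x d (a *: (h *: u) + (b *: (h *: v) + x)).
  by move=> a01 b01; rewrite addrCA; exact: inB.
have [a b a01 b01|a [b [a01 b01 E2]]] := @second_difference f x (h *: v) (h *: u).
  by have [Ay _] := dB _ (inB' b a b01 a01); split; [exact: df|exact: dZ].
have [A1 B1] := dB _ (inB _ _ s01 t01).
have [A2 B2] := dB _ (inB' _ _ b01 a01).
exists (b *: (h *: u) + (a *: (h *: v) + x)), (t *: (h *: v) + (s *: (h *: u) + x)).
split; [exact: B2|exact: B1|].
have {}E1 := etrans E1 (DZ v u _ A1); have {}E2 := etrans E2 (DZ u v _ A2).
apply: (mulfI (lt0r_neq0 h0)); apply: (mulfI (lt0r_neq0 h0)).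
rewrite -[LHS]E2 -[RHS]E1 [h *: v + (h *: u + x)]addrCA.
exact: G.
Qed.

Lemma Schwarz_rV n (F : V -> 'rV[R]_n) (A : set V) (x u v : V) : open A ->
  Ck 2 A F -> A x -> 'D_u ('D_v F) x = 'D_v ('D_u F) x.
Proof.
move=> oA cF Ax; have [df Df] := cF; apply/rowP => i.
have nA : nbhs x A by have := oA; rewrite openE; apply.
have key w w' : ('D_w ('D_w' F) x) 0 i = 'D_w ('D_w' (fun y => F y 0 i)) x.
  rewrite -derive_coord; last by have [d _] := Df w'; exact/diff_derivable/d.
  apply: near_eq_derive; apply: filterS nA => y Ay.
  by rewrite derive_coord //; exact/diff_derivable/df.
have S := @Schwarz (fun y => F y 0 i) A x u v oA (Ck_coord i oA cF) Ax.
exact (etrans (key u v) (etrans S (esym (key v u)))).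
Qed.

End Schwarz.

(** * The Poincare lemma for 1-forms *)

Lemma ball_normP (R : numFieldType) (V : normedModType R) (x y : V) (r : R) :
  ball x r y <-> `|y - x| < r.
Proof. by rewrite -ball_normE /ball_ /= distrC. Qed.

Lemma coord_norm_le (R : realType) n (v : 'rV[R]_n) (i : 'I_n) :
  `|v 0 i| <= `|v|.
Proof.
by rewrite -[leRHS]/(Num.Def.normr v) [leRHS]/Num.Def.normr /= mx_normrE
     (le_bigmax _ (fun ij => `|v ij.1 ij.2|) (0, i)).
Qed.

Lemma compact_continuous_bounded (R : realType) (T : topologicalType)
    (K : set T) (f : T -> R) : compact K ->
  (forall x, K x -> {for x, continuous f}) ->
  exists2 M : R, 0 <= M & forall x, K x -> `|f x| <= M.
Proof.
move=> cK cf.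
have cw : {within K, continuous f}.
  by apply: continuous_in_subspaceT => x; rewrite inE => /cf.
have [M [_ HM]] := compact_bounded (continuous_compact cw cK).
exists (`|M| + 1) => [|x Kx]; first by rewrite addr_ge0.
by apply: (HM (`|M| + 1)); [rewrite (le_lt_trans (ler_norm _)) // ltrDl|exists x].
Qed.

Lemma derive_diff_sum (R : realType) n (f : 'rV[R]_n -> R) (x v : 'rV[R]_n) :
  differentiable f x -> 'D_v f x = \sum_(i < n) v 0 i * 'D_(delta_mx 0 i) f x.
Proof.
move=> df; rewrite deriveE // {1}(row_sum_delta v) linear_sum /=.
by apply: eq_bigr => i _; rewrite linearZ /= deriveE.
Qed.

Lemma continuous_sumW (R : numFieldType) (T : topologicalType)
    (W : normedModType R) (I : Type) (r : seq I) (P : pred I) (F : I -> T -> W)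
    (x : T) : (forall i, P i -> {for x, continuous (F i)}) ->
  {for x, continuous (fun y => \sum_(i <- r | P i) F i y)}.
Proof.
move=> cF; elim: r => [|i r IH].
  by rewrite (_ : (fun _ => _) = cst 0); [exact: cvg_cst|apply/funext => y; rewrite big_nil].
case Pi: (P i).
  rewrite (_ : (fun _ => _) = fun y => F i y + \sum_(j <- r | P j) F j y).
    by apply: continuousD => //; exact: cF.
  by apply/funext => y; rewrite big_cons Pi.
rewrite (_ : (fun _ => _) = fun y => \sum_(j <- r | P j) F j y) //.
by apply/funext => y; rewrite big_cons Pi.
Qed.

Lemma is_derive_line0 (R : numFieldType) (V W : normedModType R) (f : V -> W)
    (x v : V) (df : W) :
  is_derive (0 : R) 1 (fun t : R => f (t *: v + x)) df -> is_derive x v f df.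
Proof.
have E : (fun h : R => h^-1 *: (((fun t : R => f (t *: v + x)) \o shift 0)
              (h *: (1 : R)) - f (0 *: v + x))) =
         (fun h : R => h^-1 *: ((f \o shift x) (h *: v) - f x)).
  by apply/funext => h /=; rewrite [h *: (1 : R)]mulr1 addr0 scale0r add0r.
by move=> [d1 d2]; split; [move: d1; rewrite /derivable E|rewrite -d2 /derive E].
Qed.

Section Poincare.
Variables (R : realType) (n : nat) (a : 'I_n -> 'rV[R]_n -> R).
Variables (x0 : 'rV[R]_n) (r : R).
Let B := ball x0 r.
Hypothesis aC1 : forall j, Ck 1 B (a j).
Hypothesis aclosed : forall (i j : 'I_n) (p : 'rV[R]_n), B p ->
  'D_(delta_mx 0 i) (a j) p = 'D_(delta_mx 0 j) (a i) p.

(** The primitive will be the integral of [psi s y] over s in [0, 1], the line integral of the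
    1-form along the segment from x0 to y. [dpsi v s] is the derivative of [psi s] in the direction
    v. *)
Let seg (s : R) (y : 'rV[R]_n) := s *: (y - x0) + x0.
Let psi (s : R) (y : 'rV[R]_n) := \sum_(j < n) (y - x0) 0 j * a j (seg s y).
Let dpsi (v : 'rV[R]_n) (s : R) (y : 'rV[R]_n) :=
  \sum_(j < n) (v 0 j * a j (seg s y) + (y - x0) 0 j * (s * 'D_v (a j) (seg s y))).

Local Lemma seg_ball (r' s : R) (y : 'rV[R]_n) : 0 <= s <= 1 ->
  ball x0 r' y -> ball x0 r' (seg s y).
Proof.
move=> /andP[s0 s1] /ball_normP yr; apply/ball_normP.
rewrite /seg addrK normrZ ger0_norm // (le_lt_trans _ yr) //.
by rewrite ler_piMl.
Qed.

Local Lemma is_diff_seg (s : R) (y : 'rV[R]_n) : differentiable (seg s) y /\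
  forall v, 'D_v (seg s) y = s *: v.
Proof.
have H : is_diff y (seg s) (fun v => s *: v).
  have := is_diffD (is_diffZ s (is_diffB (is_diff_id y) (is_diff_cst x0 y)))
    (is_diff_cst x0 y).
  by move=> /is_diff_eq; apply; apply/funext => v /=; rewrite subr0 addr0.
split; first by case: H.
by move=> v; rewrite deriveE; case: H => // ? ->.
Qed.

Local Lemma a_diff (j : 'I_n) (p : 'rV[R]_n) : B p -> differentiable (a j) p.
Proof. by move=> Bp; have [d _] := aC1 j; exact: d. Qed.

Local Lemma psi_derive (s : R) (y v : 'rV[R]_n) : 0 <= s <= 1 -> B y ->
  is_derive y v (psi s) (dpsi v s y).
Proof.
move=> s01 By; have [ds dsE] := is_diff_seg s y.
have Bs := seg_ball s01 By.
have da j : differentiable (a j) (seg s y) by exact: a_diff.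
have dj (j : 'I_n) : is_derive y v (fun y => (y - x0) 0 j * a j (seg s y))
   (v 0 j * a j (seg s y) + (y - x0) 0 j * (s * 'D_v (a j) (seg s y))).
  have d1 : is_derive y v (fun y : 'rV[R]_n => (y - x0) 0 j) (v 0 j).
    have dB : derivable (fun y : 'rV[R]_n => y - x0) y v.
      by apply: diff_derivable; apply: differentiableB.
    split; first exact: ((derivable_mxP _ _ _).1 dB 0 j).
    rewrite (derive_coord j dB) deriveB; [|exact: derivable_id|exact: derivable_cst].
    by rewrite derive_id derive_cst subr0.
  have d2 : is_derive y v (fun y => a j (seg s y)) (s * 'D_v (a j) (seg s y)).
    split; first exact/diff_derivable/(differentiable_comp ds (da j)).
    have := derive_comp v ds (da j); rewrite /comp => ->.
    by rewrite dsE derive_dirZ.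
  apply: (is_derive_eq (is_deriveM d1 d2)).
  by rewrite addrC [_ *: v 0 j]mulrC.
have := @is_derive_sum _ _ _ n (fun (j : 'I_n) y => (y - x0) 0 j * a j (seg s y)) y v _ dj.
by rewrite fct_sumE.
Qed.

(** A constant dominating function for differentiation under the integral sign. Continuity bounds
    the coefficients and their derivatives on compact sets only, whence the smaller radius r'. *)
Local Lemma dpsi_bounded (v : 'rV[R]_n) (r' : R) : 0 < r' < r ->
  exists2 M : R, 0 <= M & forall (s : R) (z : 'rV[R]_n), 0 <= s <= 1 -> ball x0 r' z ->
    `|dpsi v s z| <= M.
Proof.
move=> /andP[r'0 r'r].
have sub : closed_ball x0 r' `<=` B.
  rewrite closed_ballE // => p /= H; apply/ball_normP.
  by rewrite distrC (le_lt_trans H r'r).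
have cK : compact (closed_ball x0 r').
  apply: bounded_closed_compact; last exact: closed_ball_closed.
  exists (`|x0| + r'); split; first exact: num_real.
  move=> M HM p /=; rewrite closed_ballE // /closed_ball_/= => xp.
  rewrite (le_trans _ (ltW HM)) // -[p](subrK x0) addrC.
  by rewrite (le_trans (ler_normD _ _)) // lerD // distrC.
have bd (f : 'rV[R]_n -> R) : (forall p : 'rV[R]_n, B p -> {for p, continuous f}) ->
    exists M : R, 0 <= M /\ forall p : 'rV[R]_n, closed_ball x0 r' p -> `|f p| <= M.
  move=> cf; have [p Kp|M M0 HM] := @compact_continuous_bounded _ _ _ f cK.
    exact/cf/sub.
  by exists M.
have bda (j : 'I_n) := bd (a j) (fun p Bp => differentiable_continuous (a_diff j Bp)).
have bdD (j : 'I_n) := bd ('D_v (a j)) ((aC1 j).2 v).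
have [M H] := choice bda; have [M' H'] := choice bdD.
exists (\sum_(j < n) (`|v| * M j + r' * (1 * M' j))).
  apply: sumr_ge0 => j _; have [M0 _] := H j; have [M'0 _] := H' j.
  by rewrite addr_ge0 // !mulr_ge0 // ltW.
move=> s z s01 Bz; rewrite (le_trans (ler_norm_sum _ _ _)) // ler_sum // => j _.
have [M0 HM] := H j; have [M'0 HM'] := H' j.
have Ks : closed_ball x0 r' (seg s z) by apply: subset_closed_ball; exact: seg_ball.
have /andP[s0 s1] := s01.
rewrite (le_trans (ler_normD _ _)) // !normrM lerD //.
  by apply: ler_pM => //; [exact: coord_norm_le|exact: HM].
apply: ler_pM => //.
- apply: (le_trans (coord_norm_le _ _)).
  by move/ball_normP: Bz => /ltW.
by apply: ler_pM => //; [rewrite ger0_norm|exact: HM'].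
Qed.

Local Lemma seg_derive (y : 'rV[R]_n) (s : R) : is_derive s 1 (seg ^~ y) (y - x0).
Proof.
have := @is_derive_line R _ _ (fun p => p + x0) 0 (y - x0) s.
rewrite addr0 => H.
have d : is_derive (s *: (y - x0)) (y - x0) (fun p => p + x0) (y - x0).
  apply: (is_derive_eq (is_deriveD (is_derive_id (s *: (y - x0)) (y - x0))
     (is_derive_cst x0 (s *: (y - x0)) (y - x0)))).
  by rewrite addr0.
have [d1 d2] := d; have := H d1; rewrite d2.
rewrite (_ : (fun t : R => t *: (y - x0) + 0 + x0) = seg ^~ y) //.
by apply/funext => t; rewrite addr0.
Qed.

Local Lemma a_seg_derive (j : 'I_n) (y : 'rV[R]_n) (s : R) : 0 <= s <= 1 -> B y ->
  is_derive s 1 (fun s => a j (seg s y)) ('D_(y - x0) (a j) (seg s y)).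
Proof.
move=> s01 By; have da := a_diff j (seg_ball s01 By).
have [/derivable1_diffP d1 d2] := seg_derive y s.
split; first exact/derivable1_diffP/(differentiable_comp d1 da).
by have := @derive_comp _ _ _ _ (seg ^~ y) (a j) s (1 : R) d1 da; rewrite d2.
Qed.

(** This is where closedness enters: exchanging i and j in the partial derivatives turns the
    y-derivative of the integrand into an s-derivative. Its integral is then the boundary value at s
    = 1, the 1-form at y applied to v. *)
Local Lemma primitive_derive (y v : 'rV[R]_n) (s : R) : 0 <= s <= 1 -> B y ->
  is_derive s 1 (fun s : R => s * \sum_(j < n) v 0 j * a j (seg s y)) (dpsi v s y).
Proof.
move=> s01 By.
have dj (j : 'I_n) : is_derive s 1 (fun s => v 0 j * a j (seg s y))
    (v 0 j * 'D_(y - x0) (a j) (seg s y)).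
  apply: (is_derive_eq (is_deriveM (is_derive_cst (v 0 j) s 1)
    (a_seg_derive j s01 By))).
  by rewrite scaler0 addr0.
have ds := @is_derive_sum _ _ _ n (fun (j : 'I_n) s => v 0 j * a j (seg s y)) s 1 _ dj.
have dM := is_deriveM (is_derive_id s 1) ds.
rewrite (_ : (fun s => s * _) = id * \sum_(j < n) (fun s => v 0 j * a j (seg s y))).
  2: by apply/funext => t; rewrite /= fct_sumE.
apply: (is_derive_eq dM).
rewrite fct_sumE /dpsi big_split addrC /=; congr (_ + _); first by rewrite [LHS]mulr1.
have Bs := seg_ball s01 By.
transitivity (s * \sum_(j < n) \sum_(i < n) v 0 j * ((y - x0) 0 i *
    'D_(delta_mx 0 i) (a j) (seg s y))).
  congr (_ * _); apply: eq_bigr => j _.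
  by rewrite derive_diff_sum ?mulr_sumr //; exact: a_diff.
rewrite exchange_big mulr_sumr; apply: eq_bigr => i _.
rewrite mulrCA; congr (_ * _); rewrite derive_diff_sum; last exact: a_diff.
by rewrite !mulr_sumr; apply: eq_bigr => j _; rewrite mulrCA aclosed.
Qed.

Lemma Poincare : 0 < r -> exists f : 'rV[R]_n -> R, f x0 = 0 /\
  forall y : 'rV[R]_n, B y -> differentiable f y /\
    forall v, 'D_v f y = \sum_(j < n) v 0 j * a j y.
Proof.
move=> r0.
pose mu := @lebesgue_measure R.
pose f y := \int[mu]_(s in `[0, 1]) psi s y.
have psi_cont y : B y -> {within `[0, 1], continuous psi ^~ y}.
  move=> By; apply: continuous_in_subspaceT => s; rewrite inE /= in_itv /= => s01.
  apply: (@differentiable_continuous _ _ _ s (psi ^~ y)).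
  rewrite (_ : psi ^~ y =
      \sum_(j < n) (fun s : R => (y - x0) 0 j * a j (seg s y))); last first.
    by apply/funext => t; rewrite fct_sumE.
  apply: differentiable_sum => j; apply: differentiableM => //.
  by have [/derivable1_diffP] := a_seg_derive j s01 By.
have psi_int y : B y -> mu.-integrable `[0, 1] (EFin \o psi ^~ y).
  move=> By; apply: continuous_compact_integrable; first exact: segment_compact.
  exact: psi_cont.
have fd y v : B y -> is_derive y v f (\sum_(j < n) v 0 j * a j y).
  move=> By.
  (* A radius strictly between |y - x0| and r, namely their midpoint: the domination holds on a ball
     smaller than B that still contains y. *)
  have [r' /andP[r'0 r'r] yr'] : exists2 r' : R, 0 < r' < r & ball x0 r' y.
    exists ((r + `|y - x0|) / 2); last first.
      by apply/ball_normP; move/ball_normP: By; lra.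
    by move/ball_normP: By => By; have := normr_ge0 (y - x0); lra.
  have [d d0 Hd] : exists2 d : R, 0 < d & forall e : R, `|e| < d ->
      ball x0 r' (e *: v + y).
    have v1 : 0 < `|v| + 1 by rewrite ltr_wpDl.
    have yr0 : 0 < r' - `|y - x0| by rewrite subr_gt0; apply/ball_normP.
    exists ((r' - `|y - x0|) / (`|v| + 1)); first by rewrite divr_gt0.
    move=> e; rewrite ltr_pdivlMr // => ed; apply/ball_normP.
    rewrite -addrA (le_lt_trans (ler_normD _ _)) // normrZ -ltrBrDr.
    by rewrite (le_lt_trans _ ed) // ler_wpM2l // lerDl.
  have subB z : ball x0 r' z -> B z.
    by move=> /ball_normP H; apply/ball_normP; exact: lt_trans r'r.
  have [|M M0 HM] := @dpsi_bounded v r'; first by rewrite r'0.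
  pose F (e s : R) := psi s (e *: v + y).
  have oned : forall e : R, `]-d, d[%classic e -> `|e| < d.
    by move=> e; rewrite /= in_itv /= => ed; rewrite ltr_norml.
  have dF e s : `]-d, d[%classic e -> `[0, 1]%classic s ->
      is_derive e 1 (F ^~ s) (dpsi v s (e *: v + y)).
    move=> /oned /Hd /subB Be; rewrite /= in_itv /= => s01.
    have [p1 p2] := psi_derive v s01 Be.
    by have := is_derive_line p1; rewrite p2.
  have M' : mu.-integrable `[0, 1] (EFin \o (fun=> M)).
    apply: continuous_compact_integrable; first exact: segment_compact.
    by apply: continuous_subspaceT => z; exact: cst_continuous.
  have a0 : `]-d, d[%classic 0 by rewrite /= in_itv /= oppr_lt0 d0.
  have intF e : `]-d, d[%classic e -> mu.-integrable `[0, 1] (EFin \o F e).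
    by move=> /oned /Hd /subB; exact: psi_int.
  have dF1 e s : `]-d, d[%classic e -> `[0, 1]%classic s -> derivable (F ^~ s) e 1.
    by move=> de s01; have [] := dF e s de s01.
  have bF e s : `]-d, d[%classic e -> `[0, 1]%classic s -> `|partial1of2 F e s| <= M.
    move=> de s01; rewrite partial1of2E; have [_ ->] := dF e s de s01.
    by apply: HM; [move: s01; rewrite /= in_itv|exact/Hd/oned].
  have mI : measurable (`[0, 1]%classic : set (measurableTypeR R)).
    exact: measurable_itv.
  have E1 := @differentiation_under_integral R _ _ mu F _ mI _ _ _ a0 intF dF1
    (fun=> M) (fun=> M0) M' bF.
  have E2 := @derivable_under_integral R _ _ mu F _ mI _ _ _ a0 intF dF1
    (fun=> M) (fun=> M0) M' bF.
  apply: is_derive_line0; split => //.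
  rewrite -derive1E [LHS]E1.
  have -> : \int[mu]_(s in `[0, 1]) partial1of2 F 0 s =
            \int[mu]_(s in `[0, 1]) dpsi v s y.
    apply: eq_Rintegral => s; rewrite inE => s01; rewrite partial1of2E.
    by have [_ ->] := dF 0 s a0 s01; rewrite scale0r add0r.
  pose G (s : R) := s * \sum_(j < n) v 0 j * a j (seg s y).
  have dG (s : R) : 0 <= s <= 1 -> is_derive s 1 G (dpsi v s y).
    by move=> s01; exact: primitive_derive.
  have cG (s : R) : 0 <= s <= 1 -> {for s, continuous G}.
    by move=> /dG [/derivable1_diffP d1 _]; exact: differentiable_continuous d1.
  have dc : {within `[0, 1], continuous (fun s => dpsi v s y)}.
    apply: continuous_in_subspaceT => s; rewrite inE /= in_itv /= => s01.
    have Bs := seg_ball s01 By.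
    have cs : {for s, continuous (seg ^~ y)}.
      by have [/derivable1_diffP d1 _] := seg_derive y s; exact: differentiable_continuous d1.
    apply: continuous_sumW => j _; apply: cvgD; apply: cvgM.
    - exact: cvg_cst.
    - apply: (@continuous_comp _ _ _ (seg ^~ y) (a j)) => //.
      exact/differentiable_continuous/a_diff.
    - exact: cvg_cst.
    - apply: cvgM; first exact: cvg_id.
      apply: (@continuous_comp _ _ _ (seg ^~ y) ('D_v (a j))); first exact: cs.
      by have [_ D] := aC1 j; exact: D.
  rewrite /Rintegral (@continuous_FTC2 _ _ G) //.
  - rewrite -EFinB /= /G mul1r mul0r subr0; apply: eq_bigr => j _.
    by rewrite /seg scale1r subrK.
  - split.
    + by move=> s; rewrite in_itv /= => /andP[s0 s1]; have [] := dG s; rewrite ?ltW.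
    + by apply: cvg_at_right_filter; apply: cG; rewrite lexx ler01.
    + by apply: cvg_at_left_filter; apply: cG; rewrite lexx ler01.
  - move=> s; rewrite in_itv /= => /andP[s0 s1]; rewrite derive1E.
    by have [|_ ->] := dG s; rewrite ?ltW.
exists f; split.
  rewrite /f /Rintegral (_ : (fun s => (psi s x0)%:E) = cst 0%:E).
    by rewrite integral0.
  by apply/funext => s; rewrite /psi big1 // => j _; rewrite subrr mxE mul0r.
move=> y By; split; last by move=> v; have [] := fd y v By.
(* The directional derivatives found on the whole ball depend continuously on the point, which
   upgrades them to differentiability. *)
apply: (@differentiable_rV _ _ _ _ (fun y v => \sum_(j < n) v 0 j * a j y)).
- have : nbhs y B by apply: open_nbhs_nbhs; split => //; exact: ball_open.
  by apply: filterS => z Bz v; exact: fd.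
- move=> z v; apply: eq_bigr => j _; congr (_ * _).
  rewrite (bigD1 j) //= mxE !eqxx mul1r big1 ?addr0 // => i ij.
  by rewrite mxE eqxx (negbTE ij) mul0r.
- move=> i; rewrite (_ : (fun y => _) = a i).
    exact/differentiable_continuous/a_diff.
  apply/funext => z; rewrite (bigD1 i) //= mxE !eqxx mul1r big1 ?addr0 // => j ij.
  by rewrite mxE eqxx (negbTE ij) mul0r.
Qed.

End Poincare.

(** * Multilinear and alternating maps *)

(** Convertible to the [[eta v with j |-> x]] of [is_altform]. *)
Definition upd (k : nat) (T : Type) (v : 'I_k -> T) (j : 'I_k) (x : T) :
  'I_k -> T := fun i => if i == j then x else v i.

Lemma upd_id k (T : Type) (v : 'I_k -> T) (j : 'I_k) : upd v j (v j) = v.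
Proof. by apply/funext => i; rewrite /upd; case: eqP => [->|]. Qed.

Lemma comp_upd k (T S : Type) (g : T -> S) (v : 'I_k -> T) (j : 'I_k) (x : T) :
  (fun i => g (upd v j x i)) = upd (fun i => g (v i)) j (g x).
Proof. by apply/funext => i; rewrite /upd; case: eqP. Qed.

Lemma fcat_lshift (T : Type) k l (a : 'I_k -> T) (b : 'I_l -> T) (i : 'I_k) :
  fcat a b (lshift l i) = a i.
Proof. by rewrite /fcat (unsplitK (inl i)). Qed.

Lemma fcat_rshift (T : Type) k l (a : 'I_k -> T) (b : 'I_l -> T) (i : 'I_l) :
  fcat a b (rshift k i) = b i.
Proof. by rewrite /fcat (unsplitK (inr i)). Qed.

Lemma fcatK (T : Type) k l (v : 'I_(k + l) -> T) :
  fcat (fun i => v (lshift l i)) (fun i => v (rshift k i)) = v.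
Proof.
by apply/funext => i; case: (split_ordP i) => j ->; rewrite ?fcat_lshift ?fcat_rshift.
Qed.

Lemma comp_fcat (T S : Type) (g : T -> S) k l (a : 'I_k -> T) (b : 'I_l -> T) :
  (fun i => g (fcat a b i)) = fcat (fun i => g (a i)) (fun i => g (b i)).
Proof. by apply/funext => i; rewrite /fcat; case: (fintype.split i). Qed.

Lemma fcat_updr (T : Type) k l (a : 'I_k -> T) (b : 'I_l -> T) (j : 'I_l) x :
  fcat a (upd b j x) = upd (fcat a b) (rshift k j) x.
Proof.
apply/funext => i; rewrite /upd; case: (split_ordP i) => h ->.
  by rewrite !fcat_lshift eq_lrshift.
by rewrite !fcat_rshift eq_rshift.
Qed.

Lemma fcat_updl (T : Type) k l (a : 'I_k -> T) (b : 'I_l -> T) (j : 'I_k) x :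
  fcat (upd a j x) b = upd (fcat a b) (lshift l j) x.
Proof.
apply/funext => i; rewrite /upd; case: (split_ordP i) => h ->.
  by rewrite !fcat_lshift eq_lshift.
by rewrite !fcat_rshift eq_rlshift.
Qed.

Lemma fcat1_head (T : Type) k (v : 'I_k.+1 -> T) :
  @fcat T 1 k (fun=> v ord0) (fun i => v (lift ord0 i)) = v.
Proof.
rewrite -[RHS](@fcatK T 1 k); congr fcat; apply/funext => i.
  by congr v; apply/val_inj; rewrite /= (ord1 i).
by congr v; apply/val_inj.
Qed.

Lemma fcat1_0 (T : Type) k (a : 'I_1 -> T) (b : 'I_k -> T) :
  @fcat T 1 k a b (ord0 : 'I_k.+1) = a ord0.
Proof.
by have := fcat_lshift a b ord0; congr (_ = _); congr fcat; apply/val_inj.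
Qed.

Lemma fcat1_lift (T : Type) k (a : 'I_1 -> T) (b : 'I_k -> T) (i : 'I_k) :
  @fcat T 1 k a b (lift ord0 i : 'I_k.+1) = b i.
Proof.
by have := fcat_rshift a b i; congr (_ = _); congr fcat; apply/val_inj.
Qed.

Section Multilinear.
Variable R : realType.

Definition is_multilinear (k n : nat) (f : ('I_k -> 'rV[R]_n) -> R) : Prop :=
  forall (v : 'I_k -> 'rV[R]_n) (j : 'I_k) (c : R) (x y : 'rV[R]_n),
    f (upd v j (c *: x + y)) = c * f (upd v j x) + f (upd v j y).

Lemma altform_multilinear k n (f : ('I_k -> 'rV[R]_n) -> R) :
  is_altform f -> is_multilinear f.
Proof. by case. Qed.

Lemma contract_multilinear k n u (f : ('I_k.+1 -> 'rV[R]_n) -> R) :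
  is_multilinear f -> is_multilinear (contract u f).
Proof. by move=> mf v j c x y; rewrite /contract !fcat_updr mf. Qed.

Lemma contract_linear k n (f : ('I_k.+1 -> 'rV[R]_n) -> R) c x y v :
  is_multilinear f ->
  contract (c *: x + y) f v = c * contract x f v + contract y f v.
Proof.
move=> mf; rewrite /contract.
have E z : (fun=> z) = upd (fun=> 0) ord0 z :> ('I_1 -> 'rV[R]_n).
  by apply/funext => i; rewrite /upd (ord1 i) eqxx.
by rewrite (E (_ + _)) (E x) (E y) !fcat_updl mf.
Qed.

Lemma contract_altform k n u (f : ('I_k.+1 -> 'rV[R]_n) -> R) :
  is_altform f -> is_altform (contract u f).
Proof.
move=> [mf af]; split; first exact: contract_multilinear.
move=> v i j ij vij; apply: (af _ (rshift 1 i) (rshift 1 j)).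
  by move: ij; rewrite -(@eq_rshift 1 k).
by rewrite !fcat_rshift.
Qed.

Lemma contract_suml k n (f : ('I_k.+1 -> 'rV[R]_n) -> R) (J : Type) (r : seq J)
    (c : J -> R) (b : J -> 'rV[R]_n) v : is_multilinear f ->
  contract (\sum_(j <- r) c j *: b j) f v = \sum_(j <- r) c j * contract (b j) f v.
Proof.
move=> mf; elim: r => [|j r IH].
  rewrite !big_nil; have := contract_linear (-1) 0 0 v mf.
  by rewrite scaler0 addr0 mulN1r addNr.
by rewrite !big_cons contract_linear // IH.
Qed.

(** Induction on the arity: [contract] splits off the first argument, and a function on ['I_k.+1] is
    a head together with a function on ['I_k]. *)
Lemma multilinear_sum k n (f : ('I_k -> 'rV[R]_n) -> R) (J : finType)
    (c : 'I_k -> J -> R) (b : 'I_k -> J -> 'rV[R]_n) : is_multilinear f ->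
  f (fun i => \sum_j c i j *: b i j) =
  \sum_(I : {ffun 'I_k -> J}) (\prod_i c i (I i)) * f (fun i => b i (I i)).
Proof.
elim: k f c b => [|k IH] f c b mf.
  have I0 : 'I_0 -> J by case.
  rewrite (big_pred1 (finfun I0)); last first.
    by move=> I /=; apply/esym/eqP/ffunP => -[].
  by rewrite big_ord0 mul1r; congr f; apply/funext => -[].
rewrite -[X in f X = _](@fcat1_head _ k) -/(contract _ f _) contract_suml //.
under eq_bigr => j _ do
  rewrite (IH _ (fun i => c (lift ord0 i)) (fun i => b (lift ord0 i))
           (contract_multilinear _ mf)) mulr_sumr.
rewrite pair_bigA /=.
pose h (p : J * {ffun 'I_k -> J}) : {ffun 'I_k.+1 -> J} :=
  [ffun i => if unlift ord0 i is Some i' then p.2 i' else p.1].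
pose g (I : {ffun 'I_k.+1 -> J}) := (I ord0, [ffun i => I (lift ord0 i)]).
rewrite [RHS](reindex h) /=; last first.
  exists g => [[j I] _|I _]; rewrite /g /h /=.
    rewrite ffunE unlift_none; congr (_, _); apply/ffunP => i.
    by rewrite !ffunE liftK.
  apply/ffunP => i; rewrite !ffunE; case: unliftP => [i' ->|->] //.
  by rewrite ffunE.
apply: eq_bigr => -[j I] _ /=.
rewrite big_ord_recl mulrA; congr (_ * _ * _).
- by rewrite ffunE unlift_none.
- by apply: eq_bigr => i _; rewrite ffunE liftK.
- rewrite /contract -[X in _ = f X](@fcat1_head _ k).
  congr (f (@fcat _ 1 k _ _)).
    by apply/funext => _; rewrite ffunE unlift_none.
  by apply/funext => i; rewrite ffunE liftK.
Qed.

Lemma multilinear_basis k n (f : ('I_k -> 'rV[R]_n) -> R) w : is_multilinear f ->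
  f w = \sum_(I : {ffun 'I_k -> 'I_n}) (\prod_i w i 0 (I i)) * f (fun i => bvec R (I i)).
Proof.
move=> mf; rewrite -(multilinear_sum (fun i j => w i 0 j) (fun=> @bvec R n)) //.
by congr f; apply/funext => i; rewrite {1}(row_sum_delta (w i)).
Qed.

Lemma comp_multilinear k n (f : ('I_k -> 'rV[R]_n) -> R) m
    (L : 'rV[R]_m -> 'rV[R]_n) : is_multilinear f ->
  (forall c x y, L (c *: x + y) = c *: L x + L y) ->
  is_multilinear (fun v => f (fun i => L (v i))).
Proof. by move=> mf lL v j c x y; rewrite !comp_upd lL mf. Qed.

Lemma comp_altform k n (f : ('I_k -> 'rV[R]_n) -> R) m
    (L : 'rV[R]_m -> 'rV[R]_n) : is_altform f ->
  (forall c x y, L (c *: x + y) = c *: L x + L y) ->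
  is_altform (fun v => f (fun i => L (v i))).
Proof.
move=> [mf af] lL; split; first exact (comp_multilinear (mf : is_multilinear f) lL).
by move=> v i j ij vij; apply: (af _ i j ij); rewrite vij.
Qed.

Lemma perm_multilinear k n (f : ('I_k -> 'rV[R]_n) -> R) (s : 'S_k) :
  is_multilinear f -> is_multilinear (fun v => f (fun i => v (s i))).
Proof.
move=> mf v j c x y.
have E z : (fun i => upd v j z (s i)) = upd (fun i => v (s i)) ((s^-1)%g j) z.
  by apply/funext => i; rewrite /upd (can2_eq (permK s) (permKV s)).
by rewrite !E mf.
Qed.

Lemma scale_multilinear k n (f : ('I_k -> 'rV[R]_n) -> R) a :
  is_multilinear f -> is_multilinear (fun v => a * f v).
Proof. by move=> mf v j c x y; rewrite mf mulrDr mulrCA. Qed.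

Lemma sum_multilinear k n (J : Type) (r : seq J) (f : J -> ('I_k -> 'rV[R]_n) -> R) :
  (forall j, is_multilinear (f j)) ->
  is_multilinear (fun v => \sum_(j <- r) f j v).
Proof.
move=> mf v j c x y; rewrite mulr_sumr -big_split /=; apply: eq_bigr => i _.
exact: mf.
Qed.

Lemma mul_multilinear k l n (f : ('I_k -> 'rV[R]_n) -> R)
    (g : ('I_l -> 'rV[R]_n) -> R) :
  is_multilinear f -> is_multilinear g ->
  is_multilinear (fun v : 'I_(k + l) -> 'rV[R]_n =>
    f (fun i => v (lshift l i)) * g (fun i => v (rshift k i))).
Proof.
move=> mf mg v j c x y; case: (split_ordP j) => h ->.
  have E1 z : (fun i => upd v (lshift l h) z (lshift l i)) =
     upd (fun i => v (lshift l i)) h z.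
    by apply/funext => i; rewrite /upd eq_lshift.
  have E2 z : (fun i => upd v (lshift l h) z (rshift k i)) =
     (fun i => v (rshift k i)).
    by apply/funext => i; rewrite /upd eq_rlshift.
  by rewrite !E1 !E2 mf mulrDl mulrA.
have E1 z : (fun i => upd v (rshift k h) z (lshift l i)) =
   (fun i => v (lshift l i)).
  by apply/funext => i; rewrite /upd eq_lrshift.
have E2 z : (fun i => upd v (rshift k h) z (rshift k i)) =
   upd (fun i => v (rshift k i)) h z.
  by apply/funext => i; rewrite /upd eq_rshift.
by rewrite !E1 !E2 mg mulrDr mulrCA.
Qed.

Lemma wedge_multilinear k l n (f : ('I_k -> 'rV[R]_n) -> R)
    (g : ('I_l -> 'rV[R]_n) -> R) :
  is_multilinear f -> is_multilinear g -> is_multilinear (wedge f g).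
Proof.
move=> mf mg; apply: scale_multilinear.
apply: (@sum_multilinear _ _ _ _ (fun (s : 'S_(k + l)) v => (-1) ^+ s *
   f (fun i => v (s (lshift l i))) * g (fun i => v (s (rshift k i))))) => s.
have H := perm_multilinear s (mul_multilinear mf mg).
by move=> v j c x y; rewrite -!mulrA (scale_multilinear _ H).
Qed.

(** Expanding in the basis gives a sum over all index functions I, each weighted by the determinant
    of the selected columns. A repeated column kills the term, and the remaining I are permutations,
    contributing their sign times the determinant of w. *)
Lemma antisym_det n (h : ('I_n -> 'rV[R]_n) -> R) w : is_multilinear h ->
  \sum_(s : 'S_n) (-1) ^+ s * h (fun i => w (s i)) =
  \det (\matrix_(i, j) w i 0 j) *
  \sum_(s : 'S_n) (-1) ^+ s * h (fun i => bvec R (s i)).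
Proof.
move=> mh; set W := \matrix_(i, j) _.
transitivity (\sum_(I : {ffun 'I_n -> 'I_n})
    \det (\matrix_(i, j) W j (I i)) * h (fun i => bvec R (I i))).
  under eq_bigr => s _ do rewrite (multilinear_basis _ mh) mulr_sumr.
  rewrite exchange_big; apply: eq_bigr => I _; rewrite /determinant mulr_suml.
  apply: eq_bigr => s _; rewrite mulrA; congr (_ * _ * _).
  by apply: eq_bigr => i _; rewrite !mxE.
rewrite (bigID (fun I : {ffun 'I_n -> 'I_n} => injectiveb I)) /= addrC big1 ?add0r.
  rewrite (reindex (@pval _)) /=; last first.
    pose in_Sn := insubd (1%g : 'S_n).
    by exists in_Sn => /= f Uf; first apply: val_inj; apply: insubdK.
  rewrite mulr_sumr; apply: eq_big => /= [s|s _]; first exact: (valP s).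
  rewrite mulrA; congr (_ * _); last first.
    by congr h; apply/funext => i; rewrite pvalE.
  rewrite (_ : (\matrix_(i, j) _) = row_perm s W^T); last first.
    by apply/matrixP => i j; rewrite !mxE pvalE.
  by rewrite row_permE det_mulmx det_perm det_tr mulrC.
move=> I /injectivePn [i [j ij Iij]].
rewrite (determinant_alternate ij) ?mul0r // => x; by rewrite !mxE Iij.
Qed.

(** A wedge product of top degree is determined by its value on the standard basis. Thus the metric
    equation, stated for all w, becomes an equation between 7 by 7 matrices. *)
Lemma wedge_det k l (f : ('I_k -> 'rV[R]_(k + l)) -> R)
    (g : ('I_l -> 'rV[R]_(k + l)) -> R) w :
  is_multilinear f -> is_multilinear g ->
  wedge f g w = \det (\matrix_(i, j) w i 0 j) * wedge f g (@bvec R (k + l)).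
Proof.
move=> mf mg; have H := antisym_det w (mul_multilinear mf mg).
rewrite /wedge mulrCA; congr (_ * _).
by under eq_bigr do rewrite -mulrA; under [in RHS]eq_bigr do rewrite -mulrA.
Qed.

End Multilinear.

Section Alternating.
Variable R : realType.

(** Polarisation: with v i + v j in both slots the form vanishes, and expanding leaves the two mixed
    terms. *)
Lemma altform_tperm k n (f : ('I_k -> 'rV[R]_n) -> R) (i j : 'I_k) v :
  is_altform f -> i != j -> f (fun h => v (tperm i j h)) = - f v.
Proof.
move=> [mf af] ij; have {}mf : is_multilinear f := mf.
pose w a b := upd (upd v i a) j b.
have wi a b : w a b i = a by rewrite /w /upd eqxx (negbTE ij).
have wj a b : w a b j = b by rewrite /w /upd eqxx.
have wa a : f (w a a) = 0 by apply: (af _ i j ij); rewrite wi wj.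
have wDr a b b' : f (w a (b + b')) = f (w a b) + f (w a b').
  by have := mf (upd v i a) j 1 b b'; rewrite scale1r mul1r.
have wC a b : w a b = upd (upd v j b) i a.
  apply/funext => h; rewrite /w /upd; case: eqP => [->|//].
  by rewrite eq_sym (negbTE ij).
have wDl a a' b : f (w (a + a') b) = f (w a b) + f (w a' b).
  by have := mf (upd v j b) i 1 a a'; rewrite scale1r mul1r -!wC.
have := wa (v i + v j); rewrite wDl !wDr !wa add0r addr0 addrC => /eqP.
rewrite addr_eq0 => /eqP E.
rewrite [X in - f X](_ : _ = w (v i) (v j)); last first.
  by rewrite /w !upd_id.
rewrite -E; congr f; apply/funext => h; rewrite /w /upd.
case: tpermP => [->|->|/eqP hi /eqP hj]; rewrite ?eqxx ?(negbTE ij) //.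
by rewrite (negbTE hi) (negbTE hj).
Qed.

Lemma altform_perm k n (f : ('I_k -> 'rV[R]_n) -> R) (s : 'S_k) v :
  is_altform f -> f (fun i => v (s i)) = (-1) ^+ s * f v.
Proof.
move=> af; have [ts -> tsd] := prod_tpermP s.
elim: ts tsd v => [|[i j] ts IH] /= => [_ v|/andP[dij tsd] v].
  rewrite big_nil odd_perm1 mul1r; congr f.
  by apply/funext => i; rewrite perm1.
rewrite big_cons odd_mul_tperm /= dij.
rewrite (_ : (fun h => _) = (fun h => (fun h' => v ((\prod_(t <- ts) tperm t.1 t.2)%g h')) (tperm i j h))).
  rewrite (altform_tperm (fun h => v ((\prod_(t <- ts) tperm t.1 t.2)%g h)) af dij).
  rewrite IH //.
  by rewrite signr_addb expr1 mulN1r mulNr.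
by apply/funext => h; rewrite permM.
Qed.

(** Slot j is brought to the front by a cycle of sign (-1) ^ j. These are the signs of [ext_d], so
    the lemma matches the terms of the exterior derivative with those of a Lie derivative. *)
Lemma altform_upd k n (f : ('I_k.+1 -> 'rV[R]_n) -> R) (j : 'I_k.+1) v x :
  is_altform f ->
  f (upd v j x) = (-1) ^+ j * contract x f (fun i => v (lift j i)).
Proof.
move=> af; have := altform_perm (lift_perm ord0 j 1%g) (upd v j x) af.
rewrite odd_lift_perm odd_perm1 addbF /= signr_odd.
move=> /(congr1 (fun z => (-1) ^+ j * z)); rewrite mulrA -exprMn mulrNN mulr1.
rewrite expr1n mul1r => <-; congr (_ * f _); rewrite -[LHS](@fcat1_head _ k).
congr (@fcat _ 1 k _ _); apply/funext => i.
  by rewrite lift_perm_id /upd eqxx.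
by rewrite lift_perm_lift perm1 /upd eq_sym (negbTE (neq_lift _ _)).
Qed.

Lemma altform_comp_sum k m (f : ('I_k -> 'rV[R]_m) -> R) : is_altform f ->
  (forall I : 'I_k -> 'I_m, injective I -> f (fun i => bvec R (I i)) = 0) ->
  forall w, f w = 0.
Proof.
move=> [mf af] H w; rewrite (multilinear_basis _ mf) big1 // => I _.
case: (boolP (injectiveb I)) => [/injectiveP inj|/injectivePn[i [j ij Iij]]].
  by rewrite H // mulr0.
by rewrite (af _ i j ij) ?mulr0 // Iij.
Qed.

Lemma altform_gt_dim k m (f : ('I_k -> 'rV[R]_m) -> R) w : is_altform f ->
  (m < k)%N -> f w = 0.
Proof.
move=> af mk; apply: altform_comp_sum => // I /leq_card.
by rewrite !card_ord leqNgt mk.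
Qed.

Lemma altform_top_dim k (f : ('I_k -> 'rV[R]_k) -> R) w : is_altform f ->
  f (fun i => bvec R i) = 0 -> f w = 0.
Proof.
move=> af f0; apply: altform_comp_sum => // I inj.
have := altform_perm (perm inj) (@bvec R k) af; rewrite f0 mulr0 => <-.
by congr f; apply/funext => i; rewrite permE.
Qed.

End Alternating.

(** * The metric of the model G2-form *)

Definition drop_nth (j : nat) (l : seq nat) : seq nat := take j l ++ drop j.+1 l.

(* Computable form of the antisymmetrised sum over the orderings of [l], the
   sign of an ordering being built up by Laplace-style extraction of its head. *)
Fixpoint altsum (n : nat) (l : seq nat) (F : seq nat -> int) : int :=
  if n is n'.+1 then
    foldr (fun j acc =>
        intZmod.addz
          (let x := altsum n' (drop_nth j l) (fun t => F (nth 0%N l j :: t)) in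
           if odd j then intZmod.oppz x else x) acc)
      (Posz 0) (iota 0 n)
  else F [::].

(** A permutation is recorded by the image j of 0 and a permutation of the rest. The map is
    injective, and the cardinals (n + 1) n! and (n + 1)! agree. *)
Lemma sum_lift_perm n (G : 'S_n.+1 -> int) :
  \sum_(s : 'S_n.+1) G s =
  \sum_(j < n.+1) \sum_(s : 'S_n) G (lift_perm ord0 j s).
Proof.
rewrite pair_bigA /= (reindex (fun p : 'I_n.+1 * 'S_n => lift_perm ord0 p.1 p.2)) //.
apply/onW_bij/inj_card_bij.
  move=> [j s] [j' s'] /= E.
  have jj' : j = j' by have := congr1 (fun u : 'S__ => u ord0) E; rewrite !lift_perm_id.
  rewrite -jj' in E *; congr (_, _); apply/permP => i.
  have := congr1 (fun u : 'S__ => u (lift ord0 i)) E.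
  by rewrite !lift_perm_lift => /lift_inj.
by rewrite card_prod card_ord !card_Sn.
Qed.

(** Bridge from the big operator over ['S_n], which does not compute, to the recursion that does.
    The image j of 0 is split off, and [lift_perm ord0 j s] has sign (-1) ^ j times that of s. *)
Lemma altsumE n l (F : seq nat -> int) : size l = n ->
  \sum_(s : 'S_n) (-1) ^+ s * F [seq nth 0%N l (s i) | i <- enum 'I_n] =
  altsum n l F.
Proof.
elim: n l F => [|n IH] l F sl.
  rewrite (big_pred1 (1%g : 'S_0)) => [|s]; last first.
    by apply/esym/eqP/permP => -[].
  by rewrite odd_perm1 mul1r enum_ord0.
have -> : altsum n.+1 l F = \sum_(j < n.+1) (-1) ^+ j *
    altsum n (drop_nth j l) (fun t => F (nth 0%N l j :: t)).
  rewrite -(big_mkord xpredT (fun j : nat => (-1) ^+ j *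
    altsum n (drop_nth j l) (fun t => F (nth 0%N l j :: t)))).
  rewrite /index_iota subn0 unlock /reducebig /altsum -/altsum.
  elim: (iota 0 n.+1) => //= j r ->.
  rewrite -[(-1) ^+ j]signr_odd; congr (_ + _).
  by case: (odd j); rewrite ?expr1 ?mulN1r ?expr0 ?mul1r.
rewrite sum_lift_perm; apply: eq_bigr => j _.
rewrite -IH ?mulr_sumr; last first.
  rewrite /drop_nth size_cat size_takel ?size_drop ?sl; last exact/ltnW/ltn_ord.
  by rewrite subSS subnKC // -ltnS ltn_ord.
apply: eq_bigr => s _; rewrite odd_lift_perm /= signr_addb signr_odd -mulrA; congr (_ * (_ * F _)).
rewrite enum_ordSl /= lift_perm_id; congr cons.
rewrite -map_comp; apply: eq_map => i /=; rewrite lift_perm_lift.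
rewrite /drop_nth nth_cat size_takel ?sl; last exact/ltnW/ltn_ord.
rewrite /= /bump; case: (leqP j (s i)) => ji /=.
  by rewrite nth_drop add1n addSn subnKC.
by rewrite nth_take.
Qed.

Definition delta_nat (i j : nat) : int := if i == j then Posz 1 else Posz 0.

(* The components of e^{abc}, with a, b, c numbered from 1 and i, j, k from 0. *)
Definition e3_coef (a b c i j k : nat) : int :=
  let p t := (nth 0%N [:: a; b; c] t).-1 in
  altsum 3 (iota 0 3) (fun l =>
    intRing.mulz (delta_nat i (p (nth 0%N l 0)))
     (intRing.mulz (delta_nat j (p (nth 0%N l 1))) (delta_nat k (p (nth 0%N l 2))))).

Definition g2_coef_def (i j k : nat) : int :=
  e3_coef 1 2 3 i j k - (e3_coef 1 4 5 i j k + e3_coef 1 6 7 i j k)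
  - (e3_coef 2 4 6 i j k + e3_coef 2 7 5 i j k)
  - (e3_coef 3 4 7 i j k + e3_coef 3 5 6 i j k).

(** The components are evaluated once and stored, so that the sum over the 5040 permutations below
    only looks them up. *)
Definition g2_table : seq (seq (seq int)) :=
  Eval vm_compute in
  [seq [seq [seq g2_coef_def i j k | k <- iota 0 7] | j <- iota 0 7] | i <- iota 0 7].

Definition g2_coef (i j k : nat) : int :=
  nth (Posz 0) (nth [::] (nth [::] g2_table i) j) k.

Lemma g2_coefE (i j k : 'I_7) : g2_coef i j k = g2_coef_def i j k.
Proof.
have : all (fun i => all (fun j => all (fun k => g2_coef i j k == g2_coef_def i j k)
  (iota 0 7)) (iota 0 7)) (iota 0 7) by vm_compute.
have I7 (h : 'I_7) : (h : nat) \in iota 0 7 by rewrite mem_iota add0n ltn_ord.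
by move=> /allP/(_ _ (I7 i))/allP/(_ _ (I7 j))/allP/(_ _ (I7 k))/eqP.
Qed.

(** The antisymmetrised sum behind the metric of the model form, cleared of denominators. The tests
    for zero avoid the inner sum over 24 permutations whenever the outer factor vanishes. *)
Definition g2_metric_sum (a b : nat) : int :=
  altsum 7 (iota 0 7) (fun l =>
    let x := g2_coef (nth 0%N l 4) (nth 0%N l 5) (nth 0%N l 6) in
    if x is Posz 0 then Posz 0 else
    intRing.mulz (altsum 4 (take 4 l) (fun t =>
       let y := g2_coef a (nth 0%N t 0) (nth 0%N t 1) in
       if y is Posz 0 then Posz 0 else
       intRing.mulz y (g2_coef b (nth 0%N t 2) (nth 0%N t 3)))) x).

(** The constant is 6 * (2! 2!) * (4! 3!), the factor 6 of the metric equation times the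
    normalisations of the two wedge products. After division the matrix is the identity. *)
Lemma g2_metric_sumE (a b : 'I_7) :
  g2_metric_sum a b = if a == b then 3456 else 0.
Proof.
have : all (fun a => all (fun b => g2_metric_sum a b ==
  if a == b then Posz (12 * 288) else Posz 0) (iota 0 7)) (iota 0 7) by vm_compute.
have I7 (h : 'I_7) : (h : nat) \in iota 0 7 by rewrite mem_iota add0n ltn_ord.
by move=> /allP/(_ _ (I7 a))/allP/(_ _ (I7 b))/eqP.
Qed.

Section ModelMetric.
Variable R : realType.
Local Notation model := (@g2_model R).

Lemma enum4E (T : Type) (q : 'I_4 -> T) : [seq q i | i <- enum 'I_4] =
  [:: q 0; q 1; q 2%:R; q 3%:R].
Proof.
rewrite !enum_ordSl enum_ord0 /=.
by congr [:: q _; q _; q _; q _]; apply/val_inj.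
Qed.

Lemma enum3E (T : Type) (q : 'I_3 -> T) : [seq q i | i <- enum 'I_3] =
  [:: q 0; q 1; q 2%:R].
Proof.
rewrite !enum_ordSl enum_ord0 /=.
by congr [:: q _; q _; q _]; apply/val_inj.
Qed.

Lemma altsum_real n (l : seq nat) (F : seq nat -> int) (G : 'S_n -> R) :
  size l = n ->
  (forall s, G s = (F [seq nth 0%N l (s i) | i <- enum 'I_n])%:~R) ->
  \sum_(s : 'S_n) (-1) ^+ s * G s = (altsum n l F)%:~R.
Proof.
move=> sl GF; rewrite -altsumE // rmorph_sum; apply: eq_bigr => s _.
by rewrite GF rmorphM rmorph_sign.
Qed.

Lemma e3_bvec a b c (I : 'I_3 -> 'I_7) :
  all (fun x => x <= 7)%N [:: a; b; c] ->
  e3 a b c (fun i => bvec R (I i)) =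
  (e3_coef a b c (I 0) (I 1) (I 2%:R))%:~R.
Proof.
move=> abc; rewrite /e3 /determinant; apply: altsum_real => // s.
rewrite enum3E !big_ord_recl big_ord0 mulr1 !mxE !eqxx /=.
have Hp (k : 'I_3) : nat_of_ord (inord (nth 0%N [:: a; b; c] k).-1 : 'I_7) =
    (nth 0%N [:: a; b; c] k).-1.
  rewrite inordK //; have /allP/(_ (nth 0%N [:: a; b; c] k)) := abc.
  by rewrite mem_nth //= => /(_ isT); case: nth.
have dn (i : 'I_7) (k : 'I_3) : (inord (nth 0%N [:: a; b; c] k).-1 == i)%:R =
   (delta_nat i (nth 0%N [:: a; b; c] k).-1)%:~R :> R.
  by rewrite -val_eqE /= Hp eq_sym /delta_nat; case: eqP.
have n3 (k : 'I_3) : nth 0%N [:: 0; 1; 2]%N k = k by case: k => -[|[|[|]]].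
rewrite !n3 !intrM !dn.
have -> : lift ord0 ord0 = 1 :> 'I_3 by apply/val_inj.
by have -> : lift ord0 (lift ord0 ord0) = 2%:R :> 'I_3 by apply/val_inj.
Qed.

Lemma g2_model_bvec (I : 'I_3 -> 'I_7) :
  model (fun i => bvec R (I i)) = (g2_coef (I 0) (I 1) (I 2%:R))%:~R.
Proof.
rewrite g2_coefE /g2_model /g2_coef_def !e3_bvec //.
have E (x1 x2 x3 x4 x5 x6 x7 : int) :
    (x1 - (x2 + x3) - (x4 + x5) - (x6 + x7))%:~R =
    x1%:~R - (x2%:~R + x3%:~R) - (x4%:~R + x5%:~R) - (x6%:~R + x7%:~R) :> R.
  by rewrite !rmorphB !rmorphD.
by rewrite E.
Qed.

Lemma contract_model_bvec a (J : 'I_2 -> 'I_7) :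
  contract (bvec R a) model (fun i => bvec R (J i)) =
  (g2_coef a (J 0) (J 1))%:~R.
Proof.
rewrite /contract -(comp_fcat (bvec R (n:=7)) (fun=> a) J) g2_model_bvec.
have F (i : 'I_2) (k : 'I_3) : k = lift ord0 i -> @fcat _ 1 2 (fun=> a) J k = J i.
  by move=> ->; exact: fcat1_lift.
have F0 : @fcat _ 1 2 (fun=> a) J (ord0 : 'I_3) = a by exact: fcat1_0.
have F1 : @fcat _ 1 2 (fun=> a) J (1 : 'I_3) = J 0 by apply/F/val_inj.
have F2 : @fcat _ 1 2 (fun=> a) J (2%:R : 'I_3) = J 1 by apply/F/val_inj.
congr (g2_coef _ _ _)%:~R.
- exact: (congr1 val F0).
- exact: (congr1 val F1).
- exact: (congr1 val F2).
Qed.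

Lemma e3_multilinear a b c : is_multilinear (@e3 R a b c).
Proof.
move=> v j t x y; rewrite /e3 -[X in _ = _ + X]mul1r.
apply: (determinant_multilinear (i0 := j)).
- by apply/rowP => k; rewrite !mxE /upd eqxx !mxE mul1r.
- by apply/matrixP => i k; rewrite !mxE /upd eq_sym (negbTE (neq_lift _ _)).
- by apply/matrixP => i k; rewrite !mxE /upd eq_sym (negbTE (neq_lift _ _)).
Qed.

Lemma g2_model_multilinear : is_multilinear model.
Proof.
move=> v j t x y; rewrite /g2_model !e3_multilinear; ring.
Qed.

Lemma model_wedge (a b : 'I_7) :
  6^-1 * wedge (wedge (contract (bvec R a) model)
                      (contract (bvec R b) model)) model (@bvec R 7) =
  (a == b)%:R.
Proof.
pose inner l := altsum 4 (take 4 l) (fun t => intRing.mulz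
   (g2_coef a (nth 0%N t 0) (nth 0%N t 1)) (g2_coef b (nth 0%N t 2) (nth 0%N t 3))).
(* The wedge of the two contractions on basis vectors as a quarter of an integer, 4 being 2! 2!. *)
have innerE (q : 'I_4 -> 'I_7) (l : seq nat) :
   take 4 l = [seq val (q i) | i <- enum 'I_4] ->
   wedge (contract (bvec R a) model) (contract (bvec R b) model)
     (fun i => bvec R (q i)) = 4^-1 * (inner l)%:~R.
  move=> ql; rewrite /wedge; congr (_ * _).
  under eq_bigr do rewrite -mulrA.
  rewrite /inner; apply: altsum_real => [|s]; first by rewrite ql size_map size_enum_ord.
  rewrite (contract_model_bvec a (fun i => q (s (lshift 2 i)))).
  rewrite (contract_model_bvec b (fun i => q (s (rshift 2 i)))).
  rewrite -rmorphM; congr (_%:~R).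
  have E (i : 'I_4) : nth 0%N (take 4 l) i = q i.
    rewrite ql (nth_map ord0) ?size_enum_ord //; congr (val (q _)).
    by rewrite nth_ord_enum.
  rewrite enum4E /= !E.
  by congr (g2_coef a (q (s _)) (q (s _)) * g2_coef b (q (s _)) (q (s _))); apply/val_inj.
pose outer l := intRing.mulz (inner l)
   (g2_coef (nth 0%N l 4) (nth 0%N l 5) (nth 0%N l 6)).
have wE k l n (f : ('I_k -> 'rV[R]_n) -> R) (g : ('I_l -> 'rV[R]_n) -> R) v :
  wedge f g v = ((k`! * l`!)%N%:R)^-1 *
  \sum_(s : 'S_(k + l)) (-1) ^+ s * f (fun i => v (s (lshift l i)))
                                  * g (fun i => v (s (rshift k i))) by [].
rewrite wE.
rewrite (eq_bigr (fun s : 'S_7 => 4^-1 * ((-1) ^+ s *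
   (outer [seq nth 0%N (iota 0 7) (s i) | i <- enum 'I_7])%:~R))); last first.
  move=> s _; set l := [seq _ | _ <- _].
  have lE (i : 'I_7) : nth 0%N l i = s i.
    by rewrite (nth_map ord0) ?size_enum_ord // nth_ord_enum nth_iota.
  have sl : size l = 7%N by rewrite size_map size_enum_ord.
  clearbody l.
  rewrite (@innerE (fun i => s (lshift 3 i)) l); last first.
    have s4 : size (take 4 l) = 4%N by rewrite size_takel ?sl.
    apply: (@eq_from_nth _ 0%N).
      by rewrite s4 size_map size_enum_ord.
    move=> i; rewrite s4 => i4.
    have i7 : (i < 7)%N by rewrite (leq_trans i4).
    rewrite nth_take // (nth_map ord0) ?size_enum_ord // (lE (Ordinal i7)).
    by congr (val (s _)); apply/val_inj; rewrite /= nth_enum_ord.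
  rewrite (g2_model_bvec (fun i => s (rshift 4 i))) /outer.
  have -> : nth 0%N l 4 = s (rshift 4 (0 : 'I_3)) by rewrite -lE.
  have -> : nth 0%N l 5 = s (rshift 4 (1 : 'I_3)) by rewrite -lE.
  have -> : nth 0%N l 6 = s (rshift 4 (2%:R : 'I_3)) by rewrite -lE.
  have rM (x y : int) : (intRing.mulz x y)%:~R = x%:~R * y%:~R :> R.
    by rewrite -rmorphM.
  by rewrite rM mulrCA !mulrA.
rewrite -mulr_sumr.
have -> : \sum_(s : 'S_7) (-1) ^+ s *
   (outer [seq nth 0%N (iota 0 7) (s i) | i <- enum 'I_7])%:~R =
   (altsum 7 (iota 0 7) outer)%:~R :> R by exact: altsum_real.
have -> : altsum 7 (iota 0 7) outer = g2_metric_sum a b.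
  (* The tests for zero in [g2_metric_sum] do not change the products. *)
  have z1 (x y : int) : intRing.mulz y x = if x is Posz 0 then Posz 0 else intRing.mulz y x.
    by case: x => [[|n]|n] //; exact: mulr0.
  have z2 (x y : int) : intRing.mulz x y = if x is Posz 0 then Posz 0 else intRing.mulz x y.
    by case: x => [[|n]|n] //; exact: mul0r.
  rewrite /g2_metric_sum; congr altsum; apply/funext => l; rewrite /outer z1.
  have -> // : inner l = altsum 4 (take 4 l) (fun t =>
       let y := g2_coef a (nth 0%N t 0) (nth 0%N t 1) in
       if y is Posz 0 then Posz 0 else
       intRing.mulz y (g2_coef b (nth 0%N t 2) (nth 0%N t 3))).
  by rewrite /inner; congr altsum; apply/funext => t; exact: z2.
have -> : ((2 + 2)`! * 3`!)%N = 144%N by [].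
rewrite g2_metric_sumE; case: eqP => _; last by rewrite !mulr0.
have -> : (3456 : int)%:~R = 3456 :> R by rewrite rmorph_nat.
by rewrite /=; field.
Qed.

End ModelMetric.

(** * Naturality of the G2-star *)

Section Star.
Variable R : realType.
Local Notation form3 := (('I_3 -> 'rV[R]_7) -> R).
Implicit Types (f : form3) (A P Q : 'M[R]_7).

(** The matrix of (u, v) |-> 1/6 (u -| f) /\ (v -| f) /\ f, with values read against the standard
    determinant. It is the metric multiplied by its signed volume factor. *)
Definition metric_mx f : 'M[R]_7 := \matrix_(a, b)
  (6^-1 * wedge (wedge (contract (bvec R a) f)
                       (contract (bvec R b) f)) f (@bvec R 7)).

Lemma wedge_suml k l n (J : finType) (c : J -> R)
    (F : J -> ('I_k -> 'rV[R]_n) -> R) (g : ('I_l -> 'rV[R]_n) -> R) w :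
  wedge (fun v => \sum_j c j * F j v) g w = \sum_j c j * wedge (F j) g w.
Proof.
rewrite /wedge mulr_sumr.
under [RHS]eq_bigr do rewrite !mulr_sumr.
rewrite exchange_big; apply: eq_bigr => s _ /=.
rewrite mulr_sumr mulr_suml mulr_sumr; apply: eq_bigr => j _.
have E (a b x d e : R) : a * (b * (x * d) * e) = x * (a * (b * d * e)) by ring.
exact: E.
Qed.

Lemma wedge_sumr k l n (J : finType) (c : J -> R)
    (F : J -> ('I_l -> 'rV[R]_n) -> R) (g : ('I_k -> 'rV[R]_n) -> R) w :
  wedge g (fun v => \sum_j c j * F j v) w = \sum_j c j * wedge g (F j) w.
Proof.
rewrite /wedge mulr_sumr.
under [RHS]eq_bigr do rewrite !mulr_sumr.
rewrite exchange_big; apply: eq_bigr => s _ /=.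
rewrite !mulr_sumr; apply: eq_bigr => j _.
have E (a b x d : R) : a * (b * (x * d)) = x * (a * (b * d)) by ring.
exact: E.
Qed.

Lemma contract_basis k n (g : ('I_k.+1 -> 'rV[R]_n) -> R) (u : 'rV[R]_n) :
  is_multilinear g ->
  contract u g = fun v => \sum_a u 0 a * contract (bvec R a) g v.
Proof.
move=> mg; apply/funext => v; rewrite {1}(row_sum_delta u) contract_suml //.
Qed.

Lemma metric_mxE f (u v : 'rV[R]_7) (w : 'I_7 -> 'rV[R]_7) : is_multilinear f ->
  6^-1 * wedge (wedge (contract u f) (contract v f)) f w =
  (u *m metric_mx f *m v^T) 0 0 * \det (\matrix_(i, j) w i 0 j).
Proof.
move=> mf.
rewrite (@wedge_det R (2 + 2) 3 _ f w) //; last first.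
  by apply: wedge_multilinear; exact: contract_multilinear.
rewrite mulrCA mulrC; congr (_ * _).
have W : wedge (contract u f) (contract v f) =
    (fun x : 'I_(2 + 2) -> 'rV[R]_7 => \sum_b v 0 b * \sum_a u 0 a *
     wedge (contract (bvec R a) f) (contract (bvec R b) f) x).
  apply/funext => x; rewrite (contract_basis u mf) (contract_basis v mf).
  by rewrite wedge_sumr; apply: eq_bigr => b _; rewrite wedge_suml.
rewrite W wedge_suml mxE.
under eq_bigr => b _ do rewrite wedge_suml.
rewrite mulr_sumr; apply: eq_bigr => b _; rewrite !mxE mulr_suml.
rewrite !mulr_sumr; apply: eq_bigr => a _; rewrite !mxE.
have E (x y z t : R) : x * (y * (z * t)) = z * (x * t) * y by ring.
exact: E.
Qed.

(** The values of this bilinear form are forms of top degree, whence the extra factor [\det A] under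
    pull-back. *)
Lemma metric_mx_comp f f' A : is_multilinear f' ->
  (forall v, f v = f' (fun i => v i *m A)) ->
  metric_mx f = \det A *: (A *m metric_mx f' *m A^T).
Proof.
move=> mf' /funext ->; apply/matrixP => a b.
rewrite mxE.
have E u : contract u (fun v => f' (fun i => v i *m A)) =
    fun v => contract (u *m A) f' (fun i => v i *m A).
  apply/funext => v; rewrite /contract.
  by rewrite (@comp_fcat _ _ (fun x => x *m A) 1 2).
rewrite !E -[LHS]/(6^-1 * wedge (wedge (contract (bvec R a *m A) f')
  (contract (bvec R b *m A) f')) f' (fun i => bvec R i *m A)).
rewrite metric_mxE // mulrC !mxE; congr (_ * _).
  by congr (\det _); apply/matrixP => i j; rewrite mxE -rowE mxE.
apply: eq_bigr => c _; rewrite /bvec -mulmxA -!rowE; congr (_ * _).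
  by rewrite mxE.
by rewrite !mxE.
Qed.

Lemma det_multilinear n :
  is_multilinear (fun w : 'I_n -> 'rV[R]_n => \det (\matrix_(i, j) w i 0 j)).
Proof.
move=> v j t x y; rewrite -[X in _ = _ + X]mul1r.
apply: (determinant_multilinear (i0 := j)).
- by apply/rowP => k; rewrite !mxE /upd eqxx !mxE mul1r.
- by apply/matrixP => i k; rewrite !mxE /upd eq_sym (negbTE (neq_lift _ _)).
- by apply/matrixP => i k; rewrite !mxE /upd eq_sym (negbTE (neq_lift _ _)).
Qed.

Lemma hodge_altform k l (G : 'M[R]_(k + l)) o (g : ('I_k -> 'rV[R]_(k + l)) -> R) :
  is_altform (hodge G o g).
Proof.
split.
  suff H : is_multilinear (hodge G o g) by exact: H.
  apply: scale_multilinear.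
  apply: (@sum_multilinear _ _ _ _ _ (fun (I : {ffun 'I_k -> 'I_(k + l)}) v =>
    \sum_(J : {ffun 'I_k -> 'I_(k + l)})
     (\prod_(i < k) invmx G (I i) (J i)) * g (fun i => bvec R (J i))
     * dvol G o (fcat (fun i => bvec R (I i)) v))) => I.
  apply: (@sum_multilinear _ _ _ _ _ (fun (J : {ffun 'I_k -> 'I_(k + l)}) v =>
     (\prod_(i < k) invmx G (I i) (J i)) * g (fun i => bvec R (J i))
     * dvol G o (fcat (fun i => bvec R (I i)) v))) => J.
  do 2 apply: scale_multilinear.
  by move=> v j c x y; rewrite !fcat_updr (@det_multilinear (k + l)).
move=> v i j ij vij; rewrite /hodge.
rewrite big1 ?mulr0 // => I _; rewrite big1 // => J _; rewrite /dvol.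
rewrite [\det (\matrix_(_, _) _)](@determinant_alternate _ _ _ (rshift k i)
  (rshift k j)) ?mulr0 //.
  by rewrite eq_rshift.
by move=> h; rewrite !mxE !fcat_rshift vij.
Qed.

(* The Hodge star of [f] for the inverse metric [P], without the factor
   coming from [\det G] in the volume form. *)
Definition star_sum P f (v : 'I_4 -> 'rV[R]_7) : R :=
  (3`!%:R)^-1 * \sum_(I : {ffun 'I_3 -> 'I_7}) \sum_(J : {ffun 'I_3 -> 'I_7})
     (\prod_(i < 3) P (I i) (J i)) * f (fun i => bvec R (J i))
     * \det (\matrix_(i < 7, j < 7) @fcat _ 3 4 (fun i => bvec R (I i)) v i 0 j).

(** The three entries of the inverse metric contribute s ^ 3, and the volume form the fourth factor
    s. *)
Lemma hodge_scale (s : R) (B : 'M[R]_7) f (o : bool) v : B \in unitmx -> s != 0 ->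
  (-1) ^+ o * Num.sqrt (\det (s^-1 *: B)) = s ->
  @hodge R 3 4 (s^-1 *: B) o f v = s ^+ 4 * star_sum (invmx B) f v.
Proof.
move=> uB s0 sE; rewrite /hodge /star_sum mulrCA; congr (_ * _).
rewrite mulr_sumr; apply: eq_bigr => I _; rewrite mulr_sumr; apply: eq_bigr => J _.
have uZ : s^-1 *: B \in unitmx.
  by rewrite unitmxE detZ unitrM unitrX ?unitrV ?unitfE // -unitfE -unitmxE.
rewrite /dvol sE invmxZ // invrK.
rewrite (eq_bigr (fun i : 'I_3 => s * invmx B (I i) (J i))); last first.
  by move=> i _; rewrite mxE.
rewrite big_split /= prodr_const card_ord.
have E (x y z t : R) : x ^+ 3 * y * z * (x * t) = x ^+ 4 * (y * z * t) by ring.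
exact: E.
Qed.

Lemma powR_pow9 (x : R) : 0 <= x -> (x ^+ 9) `^ (2 / 9) = x ^+ 2.
Proof.
move=> x0; rewrite -(powR_mulrn 9 x0) -powRrM.
by rewrite (_ : 9%:R * (2 / 9) = 2%:R :> R) ?powR_mulrn //; field.
Qed.

(* If s is the signed volume factor of the metric G then the metric equation reads
   s *: G = B, so that \det B = s ^ 9 and the star is s ^ 4 times a polynomial in
   the entries of B^-1 and f; s ^ 4 is a smooth function of B. *)
Lemma g2_star_formula f v : is_multilinear f -> metric_mx f \in unitmx ->
  (exists Go, is_g2_metric f Go) ->
  g2_star f v = (\det (metric_mx f) ^+ 2) `^ (2 / 9) *
                star_sum (invmx (metric_mx f)) f v.
Proof.
move=> mf uB exG; rewrite /g2_star /g2_metric.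
have : is_g2_metric f (xget (1%:M, false) [set Go | is_g2_metric f Go]).
  have [Go HGo] := exG.
  exact: (@xgetPex _ _ [set Go | is_g2_metric f Go] (ex_intro _ Go HGo)).
case: (xget _ _) => G o /= [_ HG].
pose s := (-1) ^+ o * Num.sqrt (\det G).
set B := metric_mx f in uB *.
have BG : B = s *: G.
  apply/matrixP => a b; have := HG (bvec R a) (bvec R b) (@bvec R 7).
  rewrite metric_mxE // /dvol -/s.
  rewrite (_ : \matrix_(_, _) _ = 1%:M); last first.
    by apply/matrixP => i j; rewrite !mxE eqxx eq_sym.
  rewrite det1 !mulr1 /bvec -!rowE -/s => E.
  have e (P : 'M[R]_7) : (row a P *m (delta_mx 0 b : 'rV[R]_7)^T) 0 0 = P a b.
    rewrite mxE (bigD1 b) //= big1 ?addr0 => [|j jb]; rewrite !mxE !eqxx ?mulr1 //.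
    by rewrite (negbTE jb) mulr0.
  by rewrite [RHS]mxE mulrC; apply/esym; move: E; rewrite !e.
have dB0 : \det B != 0 by rewrite -unitfE -unitmxE.
have dBE : \det B = s ^+ 7 * \det G by rewrite BG detZ.
have s0 : s != 0.
  by apply: contra_neq dB0 => s0; rewrite dBE s0 expr0n mul0r.
have dG : \det G = s ^+ 2.
  (* A negative determinant would have square root 0 by convention, contradicting s != 0. *)
  rewrite /s exprMn sqrr_sign mul1r sqr_sqrtr //; rewrite leNgt; apply/negP => dG0.
  by move: s0; rewrite /s ler0_sqrtr ?mulr0 ?eqxx // ltW.
have GE : G = s^-1 *: B by rewrite BG scalerA mulVf // scale1r.
rewrite [in LHS]GE hodge_scale -?GE //; congr (_ * _).
have -> : \det B ^+ 2 = (s ^+ 2) ^+ 9 by rewrite dBE dG -exprD -!exprM.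
by rewrite powR_pow9 ?sqr_ge0 // -exprM.
Qed.

Lemma g2_form_multilinear f : g2_form f -> is_multilinear f.
Proof.
move=> [E _ fE]; rewrite (_ : f = fun v => g2_model (fun i => v i *m invmx E)).
  apply: (@comp_multilinear _ _ _ (@g2_model R) _ (mulmxr (invmx E))).
    exact: g2_model_multilinear.
  by move=> c x y; rewrite linearP.
exact/funext.
Qed.

Lemma metric_mx_model : metric_mx (@g2_model R) = 1%:M.
Proof. by apply/matrixP => a b; rewrite mxE model_wedge mxE. Qed.

Lemma g2_form_metric_mx f : g2_form f ->
  exists2 A, A \in unitmx & metric_mx f = \det A *: (A *m A^T).
Proof.
move=> [E uE fE]; exists (invmx E); first by rewrite unitmx_inv.
rewrite (metric_mx_comp (@g2_model_multilinear R) fE).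
by rewrite metric_mx_model mulmx1.
Qed.

Lemma g2_form_metric_unit f : g2_form f -> metric_mx f \in unitmx.
Proof.
move=> /g2_form_metric_mx [A uA ->]; rewrite unitmxE detZ det_mulmx det_tr.
by move: uA; rewrite unitmxE => uA; rewrite unitrM unitrX // unitrM uA.
Qed.

(** The standard metric of the model pulls back to G = A A^T. The square root of \det G is |\det A|,
    so orienting by the sign of \det A makes the signed volume factor equal to \det A, the factor in
    [g2_form_metric_mx]. *)
Lemma g2_metric_exists f : g2_form f -> exists Go, is_g2_metric f Go.
Proof.
move=> gf; have [A uA BE] := g2_form_metric_mx gf.
exists (A *m A^T, \det A < 0); split => /=.
  split=> [|v v0]; first by rewrite trmx_mul trmxK.
  have vA0 : v *m A != 0.
    by apply: contra_neq v0 => vA0; rewrite -[v](mulmxK uA) vA0 mul0mx.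
  rewrite mulmxA -mulmxA -trmx_mul mxE.
  have [j vAj] : exists j, (v *m A) 0 j != 0.
    apply/existsP; apply: contra_neqT vA0; rewrite negb_exists => /forallP H.
    by apply/rowP => j; rewrite [RHS]mxE; apply/eqP; have := H j; rewrite negbK.
  rewrite (bigD1 j) //= ltr_wpDr //.
    by apply: sumr_ge0 => i _; rewrite [_^T _ _]mxE -expr2 sqr_ge0.
  by rewrite [_^T _ _]mxE -expr2 lt0r sqr_ge0 sqrf_eq0 vAj.
move=> u v w; rewrite metric_mxE; last exact: g2_form_multilinear.
rewrite BE /dvol det_mulmx det_tr -expr2 sqrtr_sqr.
rewrite -numEsign -scalemxAr -scalemxAl [in RHS]mxE.
have E (x y z : R) : x * (y * z) = y * x * z by ring.
exact: E.
Qed.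

(** Summing over J first puts the rows of the inverse metric into the form, so that one sum over I
    remains. The determinant gives (\det A)^-1, and expanding the images of the basis vectors under
    A moves A from the volume form back onto the arguments of f'. *)
Lemma star_sum_comp f f' A P : is_multilinear f' -> A \in unitmx ->
  (forall v, f v = f' (fun i => v i *m A)) ->
  forall v, star_sum (invmx A^T *m P *m invmx A) f v =
            (\det A)^-1 * star_sum P f' (fun i => v i *m A).
Proof.
move=> mf' uA fE v.
have rowsum Q (g : form3) I : is_multilinear g ->
    \sum_(J : {ffun 'I_3 -> 'I_7}) (\prod_(i < 3) Q (I i) (J i)) *
       g (fun i => bvec R (J i)) = g (fun i : 'I_3 => row (I i) Q).
  move=> mg; rewrite -(multilinear_sum (fun i j => Q (I i) j) (fun=> @bvec R 7)) //.
  by congr g; apply/funext => i; rewrite [RHS]row_sum_delta; apply: eq_bigr => j _; rewrite mxE.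
have mf : is_multilinear f.
  rewrite (_ : f = fun v => f' (fun i => v i *m A)); last exact/funext.
  by apply: (@comp_multilinear _ _ _ f' _ (mulmxr A)) => // c x y; rewrite linearP.
pose D (x : 'I_3 -> 'rV[R]_7) (y : 'I_4 -> 'rV[R]_7) :=
  \det (\matrix_(i < 7, j < 7) @fcat _ 3 4 x y i 0 j).
have mD y : is_multilinear (D ^~ y).
  by move=> x j c a b; rewrite /D !fcat_updl (@det_multilinear (3 + 4)).
have starE Q g y : is_multilinear g -> star_sum Q g y =
   (3`!%:R)^-1 * \sum_(I : {ffun 'I_3 -> 'I_7}) g (fun i : 'I_3 => row (I i) Q) *
     D (fun i => bvec R (I i)) y.
  move=> mg; rewrite /star_sum; congr (_ * _); apply: eq_bigr => I _.
  by rewrite -mulr_suml rowsum.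
rewrite !starE // mulrCA; congr (_ * _).
pose Q := invmx A^T *m P.
have DA x : D x v = (\det A)^-1 * D (fun i => x i *m A) (fun i => v i *m A).
  have -> : D (fun i => x i *m A) (fun i => v i *m A) = D x v * \det A.
    rewrite /D -det_mulmx -(@comp_fcat _ _ (mulmxr A)); congr (\det _).
    by apply/matrixP => i j; rewrite !mxE; apply: eq_bigr => h _; rewrite !mxE.
  by rewrite mulrCA mulVf ?mulr1 // -unitfE -unitmxE.
transitivity (\sum_(I : {ffun 'I_3 -> 'I_7}) f' (fun i : 'I_3 => row (I i) Q) *
   ((\det A)^-1 * \sum_(K : {ffun 'I_3 -> 'I_7}) (\prod_(i < 3) A (I i) (K i)) *
       D (fun i => bvec R (K i)) (fun i => v i *m A))).
  apply: eq_bigr => I _; rewrite DA fE; congr (_ * (_ * _)).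
    by congr f'; apply/funext => i; rewrite -row_mul mulmxKV.
  rewrite (rowsum A (D ^~ (fun i => v i *m A)) I) //.
  by congr (D _ _); apply/funext => i; rewrite /bvec -rowE.
under eq_bigr => I _ do rewrite mulrCA mulr_sumr.
rewrite -mulr_sumr exchange_big; congr (_ * _); apply: eq_bigr => K _ /=.
rewrite (eq_bigr (fun I : {ffun 'I_3 -> 'I_7} => (\prod_i A (I i) (K i)) *
   f' (fun i : 'I_3 => row (I i) Q) * D (fun i => bvec R (K i)) (fun i => v i *m A))).
  rewrite -mulr_suml; congr (_ * _).
  rewrite -(multilinear_sum (fun i j => A j (K i)) (fun=> (fun j => row j Q))) //.
  congr f'; apply/funext => i; rewrite -[P](mulKVmx (_ : A^T \in unitmx)) ?unitmx_tr //.
  rewrite -/Q row_mul mulmx_sum_row; apply: eq_bigr => j _; by rewrite !mxE.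
by move=> I _; rewrite mulrA [_ * f' _]mulrC.
Qed.

Lemma invmx_uniq n (B P : 'M[R]_n) : B *m P = 1%:M -> invmx B = P.
Proof.
move=> BP; have [uB _] := mulmx1_unit BP.
by rewrite -[LHS]mulmx1 -BP mulKmx.
Qed.

Lemma g2_form_comp f f' A : A \in unitmx ->
  (forall v, f v = f' (fun i => v i *m A)) -> g2_form f' -> g2_form f.
Proof.
move=> uA fE [E uE f'E]; exists (E *m invmx A); first by rewrite unitmx_mul uE unitmx_inv.
move=> v; rewrite fE f'E; congr g2_model; apply/funext => i.
rewrite -mulmxA; congr (_ *m _); apply/esym/invmx_uniq.
by rewrite mulmxA mulmxKV // mulmxV.
Qed.

(** The powers of \det A cancel: 4 from the root of \det B ^ 2, -1 from [star_sum_comp] and -3 from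
    the three entries of the inverse matrix. The total being even, the sign of \det A does not
    matter. *)
Lemma g2_star_comp f f' A : A \in unitmx ->
  (forall v, f v = f' (fun i => v i *m A)) -> g2_form f' ->
  forall v, g2_star f v = g2_star f' (fun i => v i *m A).
Proof.
move=> uA fE gf' v; have gf := g2_form_comp uA fE gf'.
have mf' := g2_form_multilinear gf'; have uB' := g2_form_metric_unit gf'.
have uB := g2_form_metric_unit gf.
rewrite !g2_star_formula //; try exact: g2_metric_exists; try exact: g2_form_multilinear.
have BE := metric_mx_comp mf' fE.
set B' := metric_mx f' in uB' BE *; set B := metric_mx f in uB BE *.
have dA0 : \det A != 0 by rewrite -unitfE -unitmxE.
have iB : invmx B = invmx A^T *m ((\det A)^-1 *: invmx B') *m invmx A.
  apply: invmx_uniq.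
  rewrite -scalemxAr -scalemxAl BE -scalemxAl -scalemxAr scalerA.
  rewrite mulfV // scale1r -!mulmxA (mulmxA A^T) mulmxV ?unitmx_tr // mul1mx.
  by rewrite (mulmxA B') mulmxV // mul1mx mulmxV.
rewrite iB (star_sum_comp _ mf' uA fE) mulrA.
have -> : star_sum ((\det A)^-1 *: invmx B') f' (fun i => v i *m A) =
   (\det A)^-1 ^+ 3 * star_sum (invmx B') f' (fun i => v i *m A).
  rewrite /star_sum mulrCA; congr (_ * _); rewrite mulr_sumr; apply: eq_bigr => I _.
  rewrite mulr_sumr; apply: eq_bigr => J _; rewrite !mulrA; congr (_ * _ * _).
  rewrite (eq_bigr (fun i : 'I_3 => (\det A)^-1 * invmx B' (I i) (J i))); last first.
    by move=> i _; rewrite mxE.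
  by rewrite big_split /= prodr_const card_ord.
rewrite mulrA; congr (_ * _).
have -> : \det B ^+ 2 = (\det A ^+ 2) ^+ 9 * \det B' ^+ 2.
  rewrite BE detZ !det_mulmx det_tr.
  have E (x y : R) : (x ^+ 7 * (x * y * x)) ^+ 2 = (x ^+ 2) ^+ 9 * y ^+ 2 by ring.
  exact: E.
rewrite powRM; [|exact: exprn_ge0 (sqr_ge0 _)|exact: sqr_ge0].
rewrite powR_pow9 ?sqr_ge0 //.
have E (x y : R) : x != 0 -> (x ^+ 2) ^+ 2 * y * x^-1 * x^-1 ^+ 3 = y.
  by move=> x0; field.
by rewrite E.
Qed.
End Star.

(** * Charts and the torus action *)

Section Charts.
Variables (R : realType) (n : nat) (M : manifold R n).
Implicit Types (c : chart M) (p : M) (x v : 'rV[R]_n).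

Definition img c : set 'rV[R]_n := coord c @` dom c.

Lemma imgP c x : img c x -> dom c (param c x) /\ coord c (param c x) = x.
Proof. by move=> [p dp <-]; rewrite coordK. Qed.

Lemma img_coord c p : dom c p -> img c (coord c p).
Proof. by move=> dp; exists p. Qed.

Lemma nbhs_open (T : topologicalType) (A : set T) (x : T) :
  open A -> A x -> nbhs x A.
Proof. by move=> oA Ax; apply: open_nbhs_nbhs. Qed.

Lemma img_nbhs c x : img c x -> nbhs x (img c).
Proof. by apply: nbhs_open; exact: img_open. Qed.

Lemma dom_nbhs c p : dom c p -> nbhs p (dom c).
Proof. by apply: nbhs_open; exact: dom_open. Qed.

Lemma nbhs_param c x (O : set M) : img c x -> nbhs (param c x) O ->
  nbhs x [set y | img c y /\ O (param c y)].
Proof.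
move=> ix nO; have cp := param_continuous ix.
by apply: filterI; [exact: img_nbhs|exact: cp].
Qed.

Lemma nbhs_coord c p (A : set 'rV[R]_n) : dom c p -> nbhs (coord c p) A ->
  nbhs p [set q | dom c q /\ A (coord c q)].
Proof.
move=> dp nA; have cc := coord_continuous dp.
by apply: filterI; [exact: dom_nbhs|exact: cc].
Qed.

Lemma image_domI c (O : set M) :
  coord c @` (dom c `&` O) = [set y | img c y /\ O (param c y)].
Proof.
apply/seteqP; split=> [_ [p [dp Op] <-] /=|y [iy Oy]].
  by split; [exists p|rewrite coordK].
have [dy ey] := imgP iy; by exists (param c y).
Qed.

Lemma open_image_domI c (O : set M) : open O -> open (coord c @` (dom c `&` O)).
Proof.
move=> oO; rewrite image_domI openE => x [ix Ox]; apply: nbhs_param => //.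
exact: nbhs_open.
Qed.

End Charts.

Section Action.
Variables (R : realType) (n : nat) (M : manifold R n).
Variables (m : nat) (a : torus_action M m).
Implicit Types (c : chart M) (p : M) (x v : 'rV[R]_n) (t w : 'rV[R]_m).

Lemma act0 p : a 0 p = p.
Proof. by apply: act_periodic => j; rewrite mxE. Qed.

Lemma actN t p : a (- t) (a t p) = p.
Proof. by rewrite -actD addNr act0. Qed.

Lemma actC s t p : a s (a t p) = a t (a s p).
Proof. by rewrite -!actD addrC. Qed.

Lemma act_nbhs t p (O : set M) : nbhs (a t p) O ->
  nbhs (t, p) [set tp : 'rV[R]_m * M | O (a tp.1 tp.2)].
Proof. exact: (@act_continuous _ _ _ _ a (t, p)). Qed.

Lemma act_cont t p : {for p, continuous (a t)}.
Proof.
move=> O /act_nbhs [[A B] /= [nA nB] AB].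
apply: filterS nB => q Bq; apply: (AB (t, q)); split => //.
exact: nbhs_singleton nA.
Qed.

(** The action read in charts, jointly in the torus and the chart variable, so that mixed
    derivatives in both can be exchanged. *)
Definition loc c c' (tx : 'rV[R]_m * 'rV[R]_n) : 'rV[R]_n :=
  coord c' (a tx.1 (param c tx.2)).

Definition loc_dom c c' : set ('rV[R]_m * 'rV[R]_n) :=
  [set tx | img c tx.2 /\ dom c' (a tx.1 (param c tx.2))].

Lemma loc_Ck k c c' : Ck k (loc_dom c c') (loc c c').
Proof. exact: (act_smooth a c c' k). Qed.

Lemma loc_nbhs c c' (O : set M) t x : img c x -> nbhs (a t (param c x)) O ->
  nbhs (t, x) [set tx : 'rV[R]_m * 'rV[R]_n | img c tx.2 /\ O (a tx.1 (param c tx.2))].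
Proof.
move=> ix /act_nbhs [[A B] /= [nA nB] AB].
exists (A, [set y | img c y /\ B (param c y)]) => /=.
  by split=> //; exact: nbhs_param.
by move=> [s y] /= [As [iy By]]; split=> //; exact: (AB (s, param c y)).
Qed.

Lemma loc_open c c' : open (loc_dom c c').
Proof.
rewrite openE => -[t x] [/= ix dx]; apply: (loc_nbhs c') => //.
exact: dom_nbhs.
Qed.

Lemma loc_diff c c' tx : loc_dom c c' tx -> differentiable (loc c c') tx.
Proof. by move=> d; have [df _] := loc_Ck 1 c c'; exact: df. Qed.
End Action.

Section Products.
Variables (R : realType) (U V W : normedModType R).

Lemma differentiable_slicer (F : U * V -> W) (t : U) (x : V) :
  differentiable F (t, x) -> differentiable (fun y => F (t, y)) x /\
  forall v, 'D_v (fun y => F (t, y)) x = 'D_(0, v) F (t, x).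
Proof.
move=> dF.
have [d1 d2] : is_diff x (fun y : V => (t, y)) (fun v => (0, v)).
  by have := is_diff_pair (is_diff_cst t x) (is_diff_id x).
split; first exact: (@differentiable_comp _ _ _ _ (fun y : V => (t, y)) F).
move=> v; have := @derive_comp _ _ _ _ (fun y : V => (t, y)) F x v d1 dF.
by rewrite (deriveE _ d1) d2.
Qed.

Lemma differentiable_slicel (F : U * V -> W) (t : U) (x : V) :
  differentiable F (t, x) -> differentiable (fun s => F (s, x)) t /\
  forall w, 'D_w (fun s => F (s, x)) t = 'D_(w, 0) F (t, x).
Proof.
move=> dF.
have [d1 d2] : is_diff t (fun s : U => (s, x)) (fun w => (w, 0)).
  by have := is_diff_pair (is_diff_id t) (is_diff_cst x t).
split; first exact: (@differentiable_comp _ _ _ _ (fun s : U => (s, x)) F).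
move=> w; have := @derive_comp _ _ _ _ (fun s : U => (s, x)) F t w d1 dF.
by rewrite (deriveE _ d1) d2.
Qed.

End Products.

(** * Generating vector fields of the action *)

Section GeneratingFields.
Variables (R : realType) (n : nat) (M : manifold R n).
Variables (m : nat) (a : torus_action M m).
Implicit Types (c : chart M) (p : M) (x v : 'rV[R]_n) (t w : 'rV[R]_m).

Lemma loc_dom0 c x : img c x -> loc_dom a c c (0, x).
Proof. by move=> ix; split=> //=; rewrite act0; have [] := imgP ix. Qed.

Lemma loc_domP c c' t p : dom c p -> dom c' (a t p) -> loc_dom a c c' (t, coord c p).
Proof. by move=> dp dq; split=> /=; [exact: img_coord|rewrite coordK]. Qed.

Lemma loc_slice_diff c c' t x : loc_dom a c c' (t, x) ->
  differentiable (fun y => loc a c c' (t, y)) x.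
Proof. by move=> /loc_diff /differentiable_slicer []. Qed.

Lemma loc_slice_derive c c' t x v : loc_dom a c c' (t, x) ->
  'D_v (fun y => loc a c c' (t, y)) x = 'D_(0, v) (loc a c c') (t, x).
Proof. by move=> /loc_diff /differentiable_slicer [_ ->]. Qed.

(** By additivity of the action, the torus derivative at any time t is the generating field at the
    point reached. *)
Lemma gen_field_flow w c c' t x : loc_dom a c c' (t, x) ->
  gen_field a w c' (a t (param c x)) = 'D_(w, 0) (loc a c c') (t, x).
Proof.
move=> d; have [ds <-] := differentiable_slicel (loc_diff d).
rewrite /gen_field.
have -> : (fun s => coord c' (a s (a t (param c x)))) =
          (fun s => (fun s => loc a c c' (s, x)) (t + s)).
  by apply/funext => s; rewrite /loc /= addrC actD.
have := @is_derive_addl R _ _ (fun s => loc a c c' (s, x)) 0 t w.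
by rewrite addr0 => /(_ (diff_derivable ds)) [_ ->].
Qed.

Lemma gen_fieldE w c x : img c x ->
  gen_field a w c (param c x) = 'D_(w, 0) (loc a c c) (0, x).
Proof. by move=> ix; rewrite -gen_field_flow ?act0 //; exact: loc_dom0. Qed.

Lemma gen_field_linear c p k w w' : dom c p ->
  gen_field a (k *: w + w') c p = k *: gen_field a w c p + gen_field a w' c p.
Proof.
move=> dp; have := loc_diff (loc_dom0 (img_coord dp)).
move=> /differentiable_slicel [+ _]; rewrite /loc /= coordK // => ds.
exact: derive_dirP ds.
Qed.

(** Since the torus is Abelian, s.(t.p) = t.(s.p); differentiating at s = 0 shows that t carries a
    generating field to itself. *)
Lemma gen_field_equivariant w c c' t p : dom c p -> dom c' (a t p) ->
  gen_field a w c' (a t p) =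
  'D_(gen_field a w c p) (fun y => loc a c c' (t, y)) (coord c p).
Proof.
move=> dp dq.
have [ds _] := differentiable_slicel (loc_diff (loc_dom0 (img_coord dp))).
have dl := loc_slice_diff (loc_domP dp dq).
pose g s := loc a c c (s, coord c p).
have g0 : g 0 = coord c p by rewrite /g /loc /= act0 coordK.
have gE : gen_field a w c p = 'D_w g 0.
  by rewrite /gen_field /g /loc /= coordK.
rewrite gE -[in RHS]g0.
have dl' : differentiable (fun y => loc a c c' (t, y)) (g 0) by rewrite g0.
have <- := @derive_comp _ _ _ _ g (fun y => loc a c c' (t, y)) 0 w ds dl'.
apply: near_eq_derive.
have d0 : dom c (a 0 p) by rewrite act0.
have [[A B] /= [nA nB] AB] := act_nbhs (dom_nbhs d0).
apply: filterS nA => s As.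
have ds' : dom c (a s p) by apply: (AB (s, p)); split => //; exact: nbhs_singleton nB.
by rewrite /g /loc /= coordK // coordK // actC.
Qed.

Lemma gen_field_Ck k w c : Ck k (img c) (fun x => gen_field a w c (param c x)).
Proof.
have [_ D] := loc_Ck a k.+1 c c.
have S := Ck_slice (0 : 'rV[R]_m) (@loc_open _ _ _ _ a c c) (D (w, 0)).
apply: (@eq_Ck _ _ _ _ _ (fun x => 'D_(w, 0) (loc a c c) (0, x))).
- exact: img_open.
- by move=> x ix; rewrite gen_fieldE.
- by apply: Ck_sub S => x; exact: loc_dom0.
Qed.

(** Schwarz for the action map: the derivative of the field is the rate of change of the
    differential of the flow, the form in which it appears in a Lie derivative. *)
Lemma derive_gen_field w c x v : img c x ->
  'D_v (fun y => gen_field a w c (param c y)) x =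
  'D_(w, 0) ('D_(0, v) (loc a c c)) (0, x).
Proof.
move=> ix; have d0 := loc_dom0 ix.
have S := @Schwarz_rV _ _ n (loc a c c) _ (0, x) (w, 0) (0, v)
  (@loc_open _ _ _ _ a c c) (loc_Ck a 2 c c) d0.
apply: (etrans _ (esym S)).
have [_ D] := loc_Ck a 2 c c.
have [dD _] := D (w, 0).
have [_ <-] := differentiable_slicer (dD _ d0).
apply: near_eq_derive; apply: filterS (img_nbhs ix) => y iy.
exact: gen_fieldE.
Qed.

End GeneratingFields.

(** * Closed invariant forms *)

Lemma is_derive_prod (R : realType) (V : normedModType R) k (F : 'I_k -> V -> R)
    (dF : 'I_k -> R) (x v : V) : (forall i, is_derive x v (F i) (dF i)) ->
  is_derive x v (fun y => \prod_i F i y)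
    (\sum_i \prod_j (if j == i then dF j else F j x)).
Proof.
elim: k F dF => [|k IH] F dF H.
  rewrite big_ord0 (_ : (fun _ => _) = cst 1); first exact: is_derive_cst.
  by apply/funext => y; rewrite big_ord0.
have IHk := IH (fun i => F (lift ord0 i)) (fun i => dF (lift ord0 i))
  (fun i => H (lift ord0 i)).
rewrite (_ : (fun y => \prod_i F i y) =
    F ord0 * (fun y => \prod_i F (lift ord0 i) y)); last first.
  by apply/funext => y; rewrite big_ord_recl.
apply: (is_derive_eq (is_deriveM (H ord0) IHk)).
rewrite addrC big_ord_recl; congr (_ + _).
  rewrite big_ord_recl eqxx [LHS]mulrC; congr (_ * _).
rewrite [LHS]mulr_sumr; apply: eq_bigr => i _.
by rewrite big_ord_recl; congr (_ * _).
Qed.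

Lemma is_derive_big_sum (R : realType) (V W : normedModType R) (J : Type)
    (r : seq J) (F : J -> V -> W) (dF : J -> W) (x v : V) :
  (forall i, is_derive x v (F i) (dF i)) ->
  is_derive x v (fun y => \sum_(i <- r) F i y) (\sum_(i <- r) dF i).
Proof.
move=> H; elim: r => [|i r IH].
  rewrite big_nil (_ : (fun _ => _) = cst 0); first exact: is_derive_cst.
  by apply/funext => y; rewrite big_nil.
rewrite big_cons (_ : (fun _ => _) = F i + (fun y => \sum_(j <- r) F j y)).
  exact: is_deriveD.
by apply/funext => y; rewrite big_cons.
Qed.

(** Leibniz rule for a moving form with moving arguments. Expansion in the basis reduces it to
    products of scalar functions. *)
Lemma is_derive_multilinear (R : realType) k n
    (G : R -> ('I_k -> 'rV[R]_n) -> R) (dG : ('I_k -> 'rV[R]_n) -> R)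
    (X : 'I_k -> R -> 'rV[R]_n) (dX : 'I_k -> 'rV[R]_n) (t : R) :
  (\forall s \near t, is_multilinear (G s)) ->
  (forall v, is_derive t 1 (G ^~ v) (dG v)) ->
  (forall i, is_derive t 1 (X i) (dX i)) ->
  is_derive t 1 (fun s => G s (fun i => X i s))
    (dG (fun i => X i t) + \sum_i G t (upd (fun i => X i t) i (dX i))).
Proof.
move=> mG hG hX.
have mGt : is_multilinear (G t) by exact: nbhs_singleton mG.
pose S (Y : 'I_k -> R -> 'rV[R]_n) s := \sum_(I : {ffun 'I_k -> 'I_n})
  (\prod_i Y i s 0 (I i)) * G s (fun i => bvec R (I i)).
have dS (Y : 'I_k -> R -> 'rV[R]_n) dY : (forall i, is_derive t 1 (Y i) (dY i)) ->
    is_derive t 1 (S Y) (\sum_(I : {ffun 'I_k -> 'I_n})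
      ((\prod_i Y i t 0 (I i)) * dG (fun i => bvec R (I i)) +
       G t (fun i => bvec R (I i)) *
        (\sum_i \prod_j (if j == i then dY j 0 (I j) else Y j t 0 (I j))))).
  move=> hY; apply: is_derive_big_sum => I.
  have hc i : is_derive t 1 (fun s => Y i s 0 (I i)) (dY i 0 (I i)).
    have [d1 d2] := hY i; split; first exact: ((derivable_mxP _ _ _).1 d1 0 (I i)).
    by rewrite derive_coord // d2.
  exact: (is_deriveM (is_derive_prod hc) (hG _)).
have eS (Y : 'I_k -> R -> 'rV[R]_n) : \forall s \near t,
    S Y s = G s (fun i => Y i s).
  by apply: filterS mG => s ms; rewrite [RHS](multilinear_basis _ ms).
(* Multilinearity passes from [G] to its derivative, by the same expansion with constant
   arguments. *)
have dGE v : dG v = \sum_(I : {ffun 'I_k -> 'I_n}) (\prod_i v i 0 (I i)) *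
     dG (fun i => bvec R (I i)).
  have hc i : is_derive t 1 (fun=> v i) (0 : 'rV[R]_n) by exact: is_derive_cst.
  have [_ <-] := hG v.
  have [_ D] := near_eq_is_derive (eS (fun i => cst (v i))) (dS (fun i => cst (v i)) _ hc).
  rewrite [LHS]D; apply: eq_bigr => I _.
  rewrite [X in _ + _ * X]big1 ?mulr0 ?addr0 // => i _.
  by rewrite (bigD1 i) //= eqxx mxE mul0r.
apply: (near_eq_is_derive (eS X)); apply: (is_derive_eq (dS X dX hX)).
rewrite big_split /= -dGE; congr (_ + _).
under eq_bigr do rewrite mulr_sumr.
rewrite exchange_big; apply: eq_bigr => i _.
rewrite (multilinear_basis _ mGt); apply: eq_bigr => I _; rewrite mulrC.
congr (_ * _); apply: eq_bigr => j _; rewrite /upd; case: eqP => [->|//].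
by [].
Qed.

Section InvariantForms.
Variables (R : realType) (n : nat) (M : manifold R n).
Variables (m : nat) (a : torus_action M m).
Implicit Types (c : chart M) (p : M) (x : 'rV[R]_n) (t w : 'rV[R]_m).

Definition smooth_form k (sigma : preform M k) := forall c v,
  smooth_on (img c) (fun x => sigma c (param c x) v).

(* Invariance under the identity of the torus is the transformation rule under
   changes of charts, so such a [sigma] is a closed invariant form. *)
Definition closed_invariant k (sigma : preform M k) : Prop :=
  [/\ forall c p, dom c p -> is_altform (sigma c p),
      smooth_form sigma, invariant_form a sigma & closed_form sigma].

Lemma invariant_loc k (sigma : preform M k) c c' t x v :
  invariant_form a sigma -> loc_dom a c c' (t, x) ->
  sigma c' (a t (param c x)) (fun i => 'D_(0, v i) (loc a c c') (t, x)) =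
  sigma c (param c x) v.
Proof.
move=> inv d; have [ix dx] := d; have [dp ex] := imgP ix.
rewrite -(inv t c c' (param c x) v dp dx); congr (sigma _ _ _).
by apply/funext => i; rewrite ex -loc_slice_derive.
Qed.

Lemma form_diff k (sigma : preform M k) c x v : smooth_form sigma ->
  img c x -> differentiable (fun y => sigma c (param c y) v) x.
Proof. by move=> sm ix; have [d _] := sm c v 1; exact: d. Qed.

(* The left-hand side is the Lie derivative of [sigma] along the generating field
   of [w]; the second term comes from Schwarz's theorem for the action map. *)
Lemma lie_derivative0 k (sigma : preform M k) w c x v :
  (forall c p, dom c p -> is_altform (sigma c p)) ->
  smooth_form sigma -> invariant_form a sigma -> img c x ->
  'D_(gen_field a w c (param c x)) (fun y => sigma c (param c y) v) x +
  \sum_i sigma c (param c x)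
     (upd v i ('D_(v i) (fun y => gen_field a w c (param c y)) x)) = 0.
Proof.
move=> alt sm inv ix; have [dp ex] := imgP ix.
have d0 := loc_dom0 a ix.
pose y (s : R) := loc a c c (s *: w, x).
have nd : \forall s \near (0 : R), loc_dom a c c (s *: w, x).
  have := nbhs_open (@loc_open _ _ _ _ a c c) d0.
  move=> [[A B] /= [nA nB] AB].
  have := near0Z w nA; apply: filterS => s As; apply: (AB (s *: w, x)).
  by split => //; exact: nbhs_singleton nB.
have line (W : normedModType R) (F : 'rV[R]_m * 'rV[R]_n -> W) :
    differentiable F (0, x) ->
    is_derive (0 : R) 1 (fun s : R => F (s *: w, x)) ('D_(w, 0) F (0, x)).
  move=> dF; have [ds De] := differentiable_slicel dF.
  have := @is_derive_line R _ _ (fun t => F (t, x)) 0 w (0 : R).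
  rewrite scale0r add0r => /(_ (diff_derivable ds)); rewrite De.
  by rewrite (_ : (fun s : R => F (s *: w + 0, x)) = fun s : R => F (s *: w, x)) //;
    apply/funext => s; rewrite addr0.
have y0 : y 0 = x by rewrite /y /loc /= scale0r act0.
have hX i : is_derive (0 : R) 1 (fun s : R => 'D_(0, v i) (loc a c c) (s *: w, x))
    ('D_(v i) (fun y => gen_field a w c (param c y)) x).
  have [_ D] := loc_Ck a 2 c c; have [dD _] := D (0, v i).
  have L := line _ ('D_(0, v i) (loc a c c)) (dD _ d0).
  exact: (is_derive_eq L (esym (derive_gen_field a w (v i) ix))).
have X0 i : 'D_(0, v i) (loc a c c) (0 *: w, x) = v i.
  rewrite scale0r -loc_slice_derive //.
  rewrite (@near_eq_derive _ _ _ _ id); last first.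
    by apply: filterS (img_nbhs ix) => z iz; rewrite /loc /= act0; have [] := imgP iz.
  by rewrite derive_id.
pose G (s : R) u := sigma c (param c (y s)) u.
have mG : \forall s \near (0 : R), is_multilinear (G s).
  apply: filterS nd => s [_ ds]; rewrite /G /y /loc /= coordK //.
  exact/altform_multilinear/alt.
have hG u : is_derive (0 : R) 1 (G ^~ u)
    ('D_(gen_field a w c (param c x)) (fun y => sigma c (param c y) u) x).
  have [/derivable1_diffP dy ey] := line _ (loc a c c) (loc_diff d0).
  have ds : differentiable (fun z => sigma c (param c z) u) (y 0).
    by rewrite y0; exact: form_diff.
  split; first exact/derivable1_diffP/(differentiable_comp dy ds).
  have := @derive_comp _ _ _ _ y (fun z => sigma c (param c z) u) 0 1 dy ds.
  by rewrite y0 ey (gen_fieldE a w ix).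
have H := is_derive_multilinear mG hG hX.
(* Invariance makes the pull-back along the flow constant in s, so the derivative computed in [H] is
   zero. *)
have K : \forall s \near (0 : R), G s (fun i => 'D_(0, v i) (loc a c c) (s *: w, x)) =
    sigma c (param c x) v.
  apply: filterS nd => s ds; rewrite /G /y /loc /= coordK; last by case: ds.
  exact: invariant_loc.
have XE : (fun i => 'D_(0, v i) (loc a c c) (0 *: w, x)) = v by exact/funext.
have [_ E] := near_eq_is_derive K H.
by move: E; rewrite XE /G y0 => <-; exact: derive_cst.
Qed.

End InvariantForms.

(** * Contraction with generating fields *)

Section Contraction.
Variables (R : realType) (n : nat) (M : manifold R n).
Variables (m : nat) (a : torus_action M m).
Implicit Types (c : chart M) (p : M) (x : 'rV[R]_n) (t w : 'rV[R]_m).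

Definition iota_field k w (sigma : preform M k.+1) : preform M k :=
  fun c p => contract (gen_field a w c p) (sigma c p).

Section Closed.
Variables (k : nat) (sigma : preform M k.+1) (w : 'rV[R]_m).
Hypothesis alt : forall c p, dom c p -> is_altform (sigma c p).
Hypothesis sm : smooth_form sigma.
Hypothesis inv : invariant_form a sigma.
Hypothesis cl : closed_form sigma.

(** Smoothness and derivatives of forms are known on constant vectors only, so the generating field
    is expanded in the basis. *)
Lemma iota_expand c x v : img c x -> iota_field w sigma c (param c x) v =
  \sum_i gen_field a w c (param c x) 0 i *
    sigma c (param c x) (@fcat _ 1 k (fun=> bvec R i) v).
Proof.
move=> ix; have [dp _] := imgP ix.
by rewrite /iota_field (contract_basis _ (altform_multilinear (alt dp))).
Qed.

Lemma iota_smooth : smooth_form (iota_field w sigma).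
Proof.
move=> c v j; apply: (@eq_Ck _ _ _ _ _ (fun x => \sum_i
  gen_field a w c (param c x) 0 i *
    sigma c (param c x) (@fcat _ 1 k (fun=> bvec R i) v))).
- exact: img_open.
- by move=> x ix; rewrite iota_expand.
apply: Ck_sum; first exact: img_open.
move=> i; apply: CkM; first exact: img_open.
  by apply: Ck_coord; [exact: img_open|exact: gen_field_Ck].
exact: sm.
Qed.

Lemma iota_invariant : invariant_form a (iota_field w sigma).
Proof.
move=> t c c' p v dp dq; rewrite /iota_field /contract.
rewrite -[RHS](inv _ dp dq); congr (sigma _ _ _).
rewrite (gen_field_equivariant w dp dq).
rewrite -(@comp_fcat _ _ (fun u => 'D_u (fun y => coord c' (a t (param c y))) (coord c p)) 1 k).
by [].
Qed.

Lemma iota_derive c x z v : img c x ->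
  'D_z (fun y => iota_field w sigma c (param c y) v) x =
  'D_z (fun y => sigma c (param c y)
          (@fcat _ 1 k (fun=> gen_field a w c (param c x)) v)) x +
  contract ('D_z (fun y => gen_field a w c (param c y)) x) (sigma c (param c x)) v.
Proof.
move=> ix; have [dp _] := imgP ix.
pose e i := @fcat _ 1 k (fun=> bvec R i : 'rV[R]_n) v.
have ds i : is_derive x z (fun y => sigma c (param c y) (e i))
    ('D_z (fun y => sigma c (param c y) (e i)) x).
  exact/derivableP/diff_derivable/form_diff.
have dg : differentiable (fun y => gen_field a w c (param c y)) x.
  by have [d _] := gen_field_Ck a 1 w c; exact: d.
have du (i : 'I_n) : is_derive x z (fun y => gen_field a w c (param c y) 0 i)
    ('D_z (fun y => gen_field a w c (param c y)) x 0 i).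
  split; first exact: ((derivable_mxP _ _ _).1 (diff_derivable dg) 0 i).
  exact: derive_coord (diff_derivable dg).
have N : \forall y \near x, \sum_i gen_field a w c (param c y) 0 i *
    sigma c (param c y) (e i) = iota_field w sigma c (param c y) v.
  by apply: filterS (img_nbhs ix) => y iy; rewrite iota_expand.
have N' : \forall y \near x, \sum_i gen_field a w c (param c x) 0 i *
    sigma c (param c y) (e i) =
    sigma c (param c y) (@fcat _ 1 k (fun=> gen_field a w c (param c x)) v).
  apply: filterS (img_nbhs ix) => y iy; have [dy _] := imgP iy.
  rewrite -[RHS]/(contract (gen_field a w c (param c x)) (sigma c (param c y)) v).
  by rewrite (contract_basis _ (altform_multilinear (alt dy))).
have [_ ->] := near_eq_is_derive N (is_derive_big_sum _ (fun i => is_deriveM (du i) (ds i))).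
have [_ ->] := near_eq_is_derive N' (is_derive_big_sum _ (fun i =>
  is_deriveM (is_derive_cst (gen_field a w c (param c x) 0 i) x z) (ds i))).
rewrite (contract_basis _ (altform_multilinear (alt dp))) -big_split /=.
apply: eq_bigr => i _; rewrite scaler0 addr0; congr (_ + _).
by rewrite [LHS]mulrC.
Qed.

Lemma iota_closed : closed_form (iota_field w sigma).
Proof.
(* Cartan's formula: d (U -| sigma) = L_U sigma - U -| d sigma. *)
move=> c p v dp; have ix := img_coord dp.
have pE : param c (coord c p) = p by exact: coordK.
set x := coord c p in ix pE *.
rewrite /ext_d -/x.
pose U := gen_field a w c (param c x).
have L := lie_derivative0 w v alt sm inv ix.
(* d sigma evaluated on U and v, where U is frozen at its value at p: the leading term is the
   derivative along U, and the others carry one more sign. *)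
have D := cl (@fcat _ 1 k.+1 (fun=> U) v) dp.
rewrite /ext_d -/x big_ord_recl fcat1_0 expr0 mul1r in D.
have E0 : (fun i => @fcat _ 1 k.+1 (fun=> U) v (lift ord0 i)) = v.
  by apply/funext => i; rewrite fcat1_lift.
rewrite E0 in D.
have E1 (j : 'I_k.+1) : (fun i => @fcat _ 1 k.+1 (fun=> U) v (lift (lift ord0 j) i)) =
    @fcat _ 1 k (fun=> U) (fun i => v (lift j i)).
  rewrite -[LHS](@fcat1_head _ k); congr (@fcat _ 1 k _ _); apply/funext => i.
    rewrite (_ : lift (lift ord0 j) ord0 = ord0) ?fcat1_0 //; exact/val_inj.
  rewrite (_ : lift (lift ord0 j) (lift ord0 i) = lift ord0 (lift j i)).
    exact: fcat1_lift.
  apply/val_inj; rewrite /= /bump /=; case: (leqP j i) => ji.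
    by rewrite leq_add2l ji addnCA.
  by rewrite leq_add2l leqNgt ji.
rewrite (eq_bigr (fun j : 'I_k.+1 => - ((-1) ^+ j *
   'D_(v j) (fun y => sigma c (param c y)
      (@fcat _ 1 k (fun=> U) (fun i => v (lift j i)))) x))) in D; last first.
  move=> j _; rewrite fcat1_lift E1 /= /bump /= add1n exprS mulN1r mulNr.
  by [].
rewrite sumrN in D.
(* The part of the Leibniz rule with U frozen is matched by [D]. The part differentiating U is moved
   to slot j, where it is a summand of the Lie derivative. *)
rewrite (eq_bigr (fun j : 'I_k.+1 => (-1) ^+ j *
   'D_(v j) (fun y => sigma c (param c y)
      (@fcat _ 1 k (fun=> U) (fun i => v (lift j i)))) x +
   sigma c (param c x)
     (upd v j ('D_(v j) (fun y => gen_field a w c (param c y)) x)))); last first.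
  move=> j _; rewrite (iota_derive (v j) (fun i => v (lift j i)) ix) mulrDr.
  congr (_ + _).
  rewrite (altform_upd j v _ (alt _)) //; by have [] := imgP ix.
rewrite big_split /=.
move: L D; rewrite -/U => L D.
have D' := subr0_eq D.
by rewrite -D'.
Qed.

End Closed.

Lemma iota_closed_invariant k (sigma : preform M k.+1) w :
  closed_invariant a sigma -> closed_invariant a (iota_field w sigma).
Proof.
move=> [alt sm inv cl]; split.
- by move=> c p dp; apply: contract_altform; exact: alt.
- exact: iota_smooth.
- exact: iota_invariant.
- exact: iota_closed.
Qed.

(** Degrees are written k + 1 because [k'.+1 + 1] reduces to [(k' + 1).+1], so no casts occur.
    Contracting the first field first yields sigma (X_1, ..., X_k, . ), the order used in
    [multi_moment_map]. *)
Fixpoint iota_fields k : preform M (k + 1) -> ('I_k -> 'rV[R]_m) -> preform M 1 :=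
  match k return preform M (k + 1) -> ('I_k -> 'rV[R]_m) -> preform M 1 with
  | 0 => fun sigma _ => sigma
  | k'.+1 => fun sigma ws =>
      iota_fields (@iota_field (k' + 1) (ws ord0) sigma) (fun i => ws (lift ord0 i))
  end.

Lemma iota_fields_closed_invariant k (sigma : preform M (k + 1)) (w : 'I_k -> 'rV[R]_m) :
  closed_invariant a sigma -> closed_invariant a (iota_fields sigma w).
Proof.
by elim: k sigma w => //= k IH sigma ws ci; apply/IH/iota_closed_invariant.
Qed.

Lemma iota_fieldsE k (sigma : preform M (k + 1)) (w : 'I_k -> 'rV[R]_m) c p z :
  iota_fields sigma w c p (fun=> z) =
  sigma c p (fcat (fun i => gen_field a (w i) c p) (fun=> z)).
Proof.
elim: k sigma w => [|k IH] sigma ws /=.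
  by congr (sigma _ _ _); apply/funext => i; case: (split_ordP i) => [[]|] // j ->;
    rewrite fcat_rshift.
rewrite IH /iota_field /contract; congr (sigma _ _ _).
rewrite -[RHS](@fcat1_head _ (k + 1)); congr (@fcat _ 1 (k + 1) _ _); apply/funext => i.
  have := fcat_lshift (fun i => gen_field a (ws i) c p) (fun _ : 'I_1 => z) ord0.
  by move=> <-; congr fcat; exact/val_inj.
case: (split_ordP i) => j ->.
  rewrite fcat_lshift -[LHS](fcat_lshift (fun i => gen_field a (ws i) c p) (fun _ : 'I_1 => z)).
  by congr fcat; exact/val_inj.
rewrite fcat_rshift -[LHS](fcat_rshift (fun i => gen_field a (ws i) c p) (fun _ : 'I_1 => z) j).
by congr fcat; exact/val_inj.
Qed.

End Contraction.

(** * Invariant primitives *)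

Lemma oneform_linear (R : realType) n (f : ('I_1 -> 'rV[R]_n) -> R) s x y :
  is_multilinear f ->
  f (fun=> s *: x + y) = s * f (fun=> x) + f (fun=> y).
Proof.
move=> mf; have E z : (fun=> z) = upd (fun=> 0) ord0 z :> ('I_1 -> 'rV[R]_n).
  by apply/funext => i; rewrite /upd (ord1 i) eqxx.
by rewrite (E (_ + _)) (E x) (E y) mf.
Qed.

Lemma oneform_basis (R : realType) n (f : ('I_1 -> 'rV[R]_n) -> R) (v : 'rV[R]_n) :
  is_multilinear f ->
  f (fun=> v) = \sum_j v 0 j * f (fun=> delta_mx 0 j).
Proof.
move=> mf; rewrite {1}(row_sum_delta v).
elim: (index_enum 'I_n) => [|j r IH].
  rewrite !big_nil; have := oneform_linear (-1) 0 0 mf.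
  by rewrite scaler0 addr0 mulN1r addNr.
by rewrite !big_cons oneform_linear // IH.
Qed.

Section LocalPrimitive.
Variables (R : realType) (n : nat) (M : manifold R n).
Variables (m : nat) (a : torus_action M m).
Implicit Types (c : chart M) (p q : M) (x y v : 'rV[R]_n) (t u : 'rV[R]_m).

Lemma chart_primitive (alpha : preform M 1) c (x0 : 'rV[R]_n) (r : R) :
  closed_invariant a alpha -> 0 < r -> ball x0 r `<=` img c ->
  exists f : 'rV[R]_n -> R, f x0 = 0 /\ forall y : 'rV[R]_n, ball x0 r y ->
    differentiable f y /\ forall v, 'D_v f y = alpha c (param c y) (fun=> v).
Proof.
move=> [alt sm _ cl] r0 sub.
pose b (j : 'I_n) y := alpha c (param c y) (fun=> delta_mx 0 j).
have bC j : Ck 1 (ball x0 r) (b j).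
  by apply: Ck_sub sub _; exact: sm.
have bcl (i j : 'I_n) (y : 'rV[R]_n) : ball x0 r y ->
    'D_(delta_mx 0 i) (b j) y = 'D_(delta_mx 0 j) (b i) y.
  move=> /sub iy; have [dy ey] := imgP iy.
  pose v (h : 'I_2) : 'rV[R]_n := if h == ord0 then delta_mx 0 i else delta_mx 0 j.
  have := cl c (param c y) v dy; rewrite /ext_d ey big_ord_recl big_ord1.
  have -> : (fun h : 'I_1 => v (lift ord0 h)) = (fun=> delta_mx 0 j).
    by apply/funext => h; rewrite /v.
  have -> : (fun h : 'I_1 => v (lift (lift ord0 ord0) h)) = (fun=> delta_mx 0 i).
    by apply/funext => h; rewrite (ord1 h) /v.
  rewrite /v /= expr0 mul1r expr1 mulN1r => /eqP.
  by rewrite subr_eq0 => /eqP.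
have [f [f0 fD]] := Poincare bC bcl r0.
exists f; split=> // y By; have [df Df] := fD y By; split=> // v.
have [dy _] := imgP (sub _ By).
by rewrite Df [RHS](oneform_basis _ (altform_multilinear (alt _ _ dy))).
Qed.

Lemma ball_segment (V : normedModType R) (z0 z z' : V) (d s : R) :
  0 <= s <= 1 -> ball z0 d z -> ball z0 d z' -> ball z0 d (s *: (z' - z) + z).
Proof.
move=> /andP[s0 s1] /ball_normP Bz /ball_normP Bz'; apply/ball_normP.
have -> : s *: (z' - z) + z - z0 = s *: (z' - z0) + (1 - s) *: (z - z0).
  have -> : z' - z = (z' - z0) - (z - z0) by rewrite opprB addrA subrK.
  rewrite -addrA; move: (z' - z0) (z - z0) => A B.
  by rewrite scalerBr scalerBl scale1r -addrA [- _ + _]addrC.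
rewrite (le_lt_trans (ler_normD _ _)) // !normrZ !ger0_norm ?subr_ge0 //.
have [->|sn0] := eqVneq s 0; first by rewrite mul0r subr0 mul1r add0r.
have sp : 0 < s by rewrite lt0r sn0.
have H1 : s * `|z' - z0| < s * d by rewrite ltr_pM2l.
have H2 : (1 - s) * `|z - z0| <= (1 - s) * d by rewrite ler_wpM2l ?subr_ge0 // ltW.
have E : s * d + (1 - s) * d = d by ring.
by rewrite -[ltRHS]E; exact: ltr_leD.
Qed.

Lemma ball_derive0 (V : normedModType R) (f : V -> R) (z0 : V) (d : R) :
  0 < d -> (forall z v : V, ball z0 d z -> is_derive z v f 0) ->
  forall z : V, ball z0 d z -> f z = f z0.
Proof.
move=> d0 df z Bz; apply/esym; apply: derive0_segment_eq => s s01.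
exact/df/ball_segment/Bz/(ballxx z0 d0).
Qed.

Lemma is_derive_snd (U V W : normedModType R) (f : V -> W) (z v : U * V) :
  differentiable f z.2 -> is_derive z v (fun z => f z.2) ('D_(v.2) f z.2).
Proof. by move=> df; split => //; exact: (diff_derivable (v := v.2) df). Qed.

(* A compact set of representatives of the torus. *)
Definition cube : set 'rV[R]_m := [set t | forall j, 0 <= t 0 j <= 1].

Lemma cube_compact : compact cube.
Proof.
have := @rV_compact R m (fun=> `[0, 1]%classic) (fun=> @segment_compact _ _ _).
congr compact; apply/seteqP; split => t /= H j; have := H j; by rewrite in_itv.
Qed.

Lemma cube_mod t : exists2 z, integral_vector z & cube (t - z).
Proof.
exists (\row_j (Num.floor (t 0 j))%:~R).
  by move=> j; rewrite mxE intr_int.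
move=> j; rewrite !mxE; have /andP[h1 h2] := Num.Theory.floor_itv (t 0 j).
by rewrite subr_ge0 h1 lerBlDr addrC ltW // -intrD1.
Qed.

Section Family.
Variables (k : nat) (alpha : ('I_k -> 'rV[R]_m) -> preform M 1).
Hypothesis ci : forall w, closed_invariant a (alpha w).
Hypothesis basic : forall w u c p, dom c p ->
  alpha w c p (fun=> gen_field a u c p) = 0.

(** Primitives for all w on one ball, each vanishing at its centre. The common ball gives
    neighbourhoods independent of w, and the normalisation fixes the constants, so relations among
    the forms pass to the primitives. *)
Let primitive c (x0 : 'rV[R]_n) (r : R) (f : ('I_k -> 'rV[R]_m) -> 'rV[R]_n -> R) :=
  forall w, f w x0 = 0 /\ forall y : 'rV[R]_n, ball x0 r y ->
    differentiable (f w) y /\ forall v, 'D_v (f w) y = alpha w c (param c y) (fun=> v).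

Lemma primitive_near_stabilizer c p (r : R) f t : dom c p -> 0 < r ->
  ball (coord c p) r `<=` img c -> primitive c (coord c p) r f ->
  a t p = p ->
  \forall sq \near (t, p), forall w,
    f w (coord c (a sq.1 sq.2)) = f w (coord c sq.2).
Proof.
(* The function (s, y) |-> f (s . y) - f y has vanishing differential near (t, p),
   since alpha is invariant and kills the generating fields; it vanishes at (t, p). *)
move=> dp r0 sub fP tp; set x0 := coord c p in sub fP.
have pE : param c x0 = p by exact: coordK.
have ix0 : img c x0 by exact: img_coord.
have d0 : loc_dom a c c (t, x0) by split => //=; rewrite pE tp.
have l0 : loc a c c (t, x0) = x0 by rewrite /loc /= pE tp.
have nb : nbhs x0 (ball x0 r) by apply: nbhsx_ballx.
have nS : nbhs (t, x0) [set tx | loc_dom a c c tx /\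
    (ball x0 r tx.2 /\ ball x0 r (loc a c c tx))].
  apply: filterI; first by apply: nbhs_open; [exact: loc_open|].
  apply: filterI.
    by exists (setT, ball x0 r) => /=; [split => //; exact: filterT|move=> [s y] []].
  have nb' : nbhs (loc a c c (t, x0)) (ball x0 r) by rewrite l0.
  exact: (differentiable_continuous (loc_diff d0) nb').
have [d /= dpos dB] := (nbhs_ballP _ _).1 nS.
have key w z : ball (t, x0) d z -> f w (loc a c c z) = f w z.2.
  move=> Bz.
  pose g (tx : 'rV[R]_m * 'rV[R]_n) := f w (loc a c c tx) - f w tx.2.
  have [fw0 fwD] := fP w.
  have gz : g z = g (t, x0).
    apply: (@ball_derive0 _ g (t, x0) d dpos _ z Bz) => -[s y] [u v] By.
    have [ds [/= By2 Bl]] := dB _ By.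
    have [iy dy] := ds; rewrite /= in iy dy.
    have [alt _ inv _] := ci w.
    have [fd fD] := fwD _ Bl; have [fd2 fD2] := fwD _ By2.
    have dl := loc_diff ds.
    have H1 : is_derive (s, y) (u, v) (fun tx => f w (loc a c c tx))
        (alpha w c (param c y) (fun=> v)).
      split; first exact/diff_derivable/(differentiable_comp dl fd).
      have -> := @derive_comp _ _ _ _ (loc a c c) (f w) (s, y) (u, v) dl fd.
      rewrite fD {1}/loc /= coordK //.
      have -> : (u, v) = 1 *: (u, 0) + (0, v) :> 'rV[R]_m * 'rV[R]_n.
        by rewrite scale1r; congr (_, _) => /=; rewrite ?addr0 ?add0r.
      rewrite (derive_dirP _ _ _ dl) (oneform_linear _ _ _ (altform_multilinear (alt _ _ dy))).
      rewrite -gen_field_flow // basic // mulr0 add0r.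
      exact: (invariant_loc (fun=> v) inv ds).
    have H2 := @is_derive_snd _ _ _ (f w) (s, y) (u, v) fd2.
    apply: (is_derive_eq (is_deriveB H1 H2)).
    by rewrite /= fD2 subrr.
  move: gz; rewrite /g l0 /= fw0 subr0 => /eqP; rewrite subr_eq0 => /eqP; exact.
have [[A B] /= [nA nB] AB] : nbhs (t, x0) (ball (t, x0) d).
  exact: nbhsx_ballx.
have nq := nbhs_coord dp (nB : nbhs (coord c p) B).
exists (A, [set q | dom c q /\ B (coord c q)]) => //= -[s q] /= [As [dq Bq]] w.
have := key w (s, coord c q) (AB (s, coord c q) (conj As Bq)).
by rewrite /loc /= coordK.
Qed.

(** [near_covering] makes neighbourhoods found for each t uniform over the cube. Outside the
    stabiliser, disjoint neighbourhoods of t.p and p make the equation between the two points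
    impossible. *)
Lemma primitive_orbit c p (r : R) f : dom c p -> 0 < r ->
  ball (coord c p) r `<=` img c -> primitive c (coord c p) r f ->
  \forall qq \near (p, p), forall t w, qq.2 = a t qq.1 ->
    f w (coord c qq.2) = f w (coord c qq.1).
Proof.
move=> dp r0 sub fP.
have H : \forall qq \near (p, p), cube `<=` [set t | forall w, qq.2 = a t qq.1 ->
    f w (coord c qq.2) = f w (coord c qq.1)].
  have nc : near_covering cube := (compact_near_coveringP cube).1 cube_compact.
  apply: (nc _ (nbhs (p, p)) (fun qq t => forall w, qq.2 = a t qq.1 ->
    f w (coord c qq.2) = f w (coord c qq.1))) => t _.
  have [tp|/eqP tp] := pselect (a t p = p).
    have [[A B] /= [nA nB] AB] := primitive_near_stabilizer dp r0 sub fP tp.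
    exists (A, [set qq | B qq.1]) => /=.
      by split => //; exists (B, setT) => //=; [split => //; exact: filterT|move=> [? ?] []].
    move=> [s [q q']] /= [As Bq] w ->.
    by have := AB (s, q) (conj As Bq) w.
  have := @mspace_hausdorff R n M; rewrite open_hausdorff => /(_ _ _ tp).
  move=> [AB [/set_mem A0 /set_mem B0] [oA oB /eqP AB0]].
  have [[A' B'] /= [nA' nB'] H] := act_nbhs (nbhs_open oA A0).
  exists (A', [set qq | B' qq.1 /\ AB.2 qq.2]) => /=.
    by split => //; exists (B', AB.2) => //=; split => //; exact: nbhs_open.
  move=> [s [q q']] /= [As [Bq Bq']] w qE.
  suff : (AB.1 `&` AB.2) q' by rewrite AB0.
  by split => //; rewrite qE; exact: (H (s, q)).
apply: filterS H => -[q q'] /= H t w qE.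
(* Integral vectors act trivially, so t may be replaced by its representative in the cube. *)
have [z iz cz] := cube_mod t.
apply: (H _ cz) => /=.
have e : a t q = a (t - z) (a z q) by rewrite -actD subrK.
by rewrite qE e (act_periodic a q iz).
Qed.

Hypothesis lin : forall w j s u u' c p v, dom c p ->
  alpha (upd w j (s *: u + u')) c p (fun=> v) =
  s * alpha (upd w j u) c p (fun=> v) + alpha (upd w j u') c p (fun=> v).
Hypothesis alternating : forall w (i j : 'I_k) c p v, i != j -> w i = w j ->
  dom c p -> alpha w c p (fun=> v) = 0.

(** Each defect of linearity or alternation in w has zero derivative on the ball, by the same
    property of [alpha], and vanishes at the centre. *)
Lemma primitive_altform c (x0 : 'rV[R]_n) (r : R) f : 0 < r ->
  ball x0 r `<=` img c -> primitive c x0 r f ->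
  forall y : 'rV[R]_n, ball x0 r y -> is_altform (f ^~ y).
Proof.
move=> r0 sub fP y By.
have fd w z v : ball x0 r z ->
    is_derive z v (f w) (alpha w c (param c z) (fun=> v)).
  move=> Bz; have [_ /(_ _ Bz) [df Df]] := fP w.
  by split; [exact: diff_derivable|exact: Df].
split.
  suff : is_multilinear (f ^~ y) by [].
  move=> w j s u u'; apply/eqP; rewrite -subr_eq0; apply/eqP.
  pose g z := f (upd w j (s *: u + u')) z -
    (s * f (upd w j u) z + f (upd w j u') z).
  have -> : 0 = g x0.
    by rewrite /g !(fun w => (fP w).1) mulr0 addr0 subr0.
  apply: (@ball_derive0 _ g x0 r r0) By => z v Bz.
  have [dz _] := imgP (sub _ Bz).
  apply: (is_derive_eq (is_deriveB (fd _ _ v Bz) (is_deriveD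
    (is_deriveM (is_derive_cst s z v) (fd _ _ v Bz)) (fd _ _ v Bz)))).
  by rewrite scaler0 addr0 lin // subrr.
move=> w i j ij wij; rewrite -[RHS]((fP w).1).
apply: (@ball_derive0 _ (f w) x0 r r0) By => z v Bz.
have [dz _] := imgP (sub _ Bz).
apply: (is_derive_eq (fd _ _ v Bz)).
exact: (alternating v ij wij dz).
Qed.

Lemma local_invariant_primitive p0 : exists (O : set M)
    (nu : M -> ('I_k -> 'rV[R]_m) -> R),
  [/\ open O, O p0, invariant_set a O,
      forall p, O p -> is_altform (nu p) /\ forall t, nu (a t p) = nu p &
      forall w c p, O p -> dom c p ->
        differentiable (fun x => nu (param c x) w) (coord c p) /\
        forall v, 'D_v (fun x => nu (param c x) w) (coord c p) =
                  alpha w c p (fun=> v)].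
Proof.
have [c dp] := dom_cover p0.
have [r /= r0 sub] := (nbhs_ballP _ _).1 (img_nbhs (img_coord dp)).
set x0 := coord c p0 in sub.
have [f fP] := choice (fun w => chart_primitive (ci w) r0 sub).
have {}fP : primitive c x0 r f by [].
have [[A B] /= [nA nB] AB] := primitive_orbit dp r0 sub fP.
have nb : nbhs x0 (ball x0 r) by apply: nbhsx_ballx.
have nW : nbhs p0 (A `&` B `&` [set q | dom c q /\ ball x0 r (coord c q)]).
  by apply: filterI; [exact: filterI|exact: nbhs_coord].
have [W [oW Wp] WP] : exists2 W : set M, open W /\ W p0 & forall q, W q ->
   [/\ A q, B q, dom c q & ball x0 r (coord c q)].
  move: nW; rewrite nbhsE => -[W [oW Wp] H]; exists W => // q /H.
  by move=> [[Aq Bq] [dq bq]]; split.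
have fW w t q : W q -> W (a t q) -> f w (coord c (a t q)) = f w (coord c q).
  move=> /WP [Aq _ _ _] /WP [_ Bq _ _].
  exact: (AB (q, a t q) (conj Aq Bq) t w erefl).
pose O := [set q | exists t, W (a t q)].
(* An arbitrary element moving q into W. It exists on O, so the default 0 matters only outside O; by
   [fW] the value of [nu] does not depend on the choice. *)
pose tau q := xget 0 [set t | W (a t q)].
have tauP q : O q -> W (a (tau q) q).
  move=> Oq; exact: (@xgetPex _ 0 [set t | W (a t q)] Oq).
pose nu q w := f w (coord c (a (tau q) q)).
have nuE q t w : W (a t q) -> nu q w = f w (coord c (a t q)).
  move=> Wq; have Oq : O q by exists t.
  have e : a t q = a (t - tau q) (a (tau q) q) by rewrite -actD subrK.
  rewrite /nu e (fW w (t - tau q) (a (tau q) q)) //; first exact: tauP.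
  by rewrite -e.
have Oa t q : O q -> O (a t q).
  by move=> [s Ws]; exists (s - t); rewrite -actD subrK.
exists O, nu; split.
- rewrite openE => q [t Wt]; have nq : nbhs q (a t @^-1` W) := act_cont (nbhs_open oW Wt).
  by apply: filterS nq => q' Wq'; exists t.
- by exists 0; rewrite act0.
- by move=> t q; exact: Oa.
- move=> q Oq; have Wq := tauP _ Oq; have [_ _ dq bq] := WP _ Wq.
  split; first exact: (primitive_altform r0 sub fP bq).
  move=> t; apply/funext => w.
  have e : a (tau q) q = a (tau q - t) (a t q) by rewrite -actD subrK.
  by rewrite (@nuE (a t q) (tau q - t) w) -?e.
move=> w c' q Oq dq; have Wq := tauP _ Oq; have [_ _ dWq bq] := WP _ Wq.
set t := tau q in Wq dWq bq.
have [alt _ inv _] := ci w.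
have d := loc_domP dq dWq.
have [fd fD] := (fP w).2 _ bq.
(* Although [tau] may jump, the single element t = tau q still moves all points near q into W. Hence
   [nu] is locally f composed with the action of a fixed t. *)
have N : {near coord c' q, (fun y => f w (loc a c' c (t, y))) =1
    (fun y => nu (param c' y) w)}.
  have nWq : nbhs (a t (param c' (coord c' q))) W by rewrite coordK //; exact: nbhs_open.
  have nq : nbhs (param c' (coord c' q)) (a t @^-1` W) := act_cont nWq.
  have := nbhs_param (img_coord dq) nq.
  by apply: filterS => y [iy Wy]; rewrite /loc /= (nuE _ t).
have ds := loc_slice_diff d.
have l0 : loc a c' c (t, coord c' q) = coord c (a t q) by rewrite /loc /= coordK.
have fd' : differentiable (f w) (loc a c' c (t, coord c' q)) by rewrite l0.
split.
  apply: (near_eq_differentiable N).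
  exact: (@differentiable_comp _ _ _ _ (fun y => loc a c' c (t, y)) (f w)).
move=> v; rewrite -(near_eq_derive v N).
have -> := @derive_comp _ _ _ _ (fun y => loc a c' c (t, y)) (f w) (coord c' q) v ds fd'.
rewrite l0 fD (coordK dWq) (loc_slice_derive v d).
have := invariant_loc (fun=> v) inv d.
by rewrite (coordK dq).
Qed.

End Family.
End LocalPrimitive.

(** * Multi-moment maps *)

Section MultiMoment.
Variables (R : realType) (n : nat) (M : manifold R n).
Variables (m : nat) (a : torus_action M m).

Lemma multi_moment_mapS k (sigma : preform M (k + 1)) (O O' : set M) nu :
  O' `<=` O -> multi_moment_map a sigma O nu -> multi_moment_map a sigma O' nu.
Proof.
move=> OO [h1 h2 h3 h4]; split.
- by move=> p /OO; exact: h1.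
- by move=> t p /OO; exact: h2.
- move=> w c j; apply: Ck_sub (h3 w c j).
  by move=> _ [p [dp Op] <-]; exists p => //; split => //; exact: OO.
- by move=> W c p v /OO; exact: h4.
Qed.

(** The contractions are multilinear and alternating in w because generating fields are linear in
    the Lie algebra element. Their invariant primitives therefore assemble to one map into the
    alternating k-forms on the Lie algebra. *)
Lemma local_multi_moment_map k (sigma : preform M (k + 1)) p0 :
  closed_invariant a sigma ->
  (forall c p (w : 'I_(k + 1) -> 'rV[R]_m), dom c p ->
     sigma c p (fun i => gen_field a (w i) c p) = 0) ->
  exists O : set M, [/\ open O, O p0, invariant_set a O &
    exists nu, multi_moment_map a sigma O nu].
Proof.
move=> ci basic; have [alt sm inv cl] := ci.
pose alpha := iota_fields a sigma.
have cia w : closed_invariant a (alpha w) by exact: iota_fields_closed_invariant.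
have alphaE w c p v : alpha w c p (fun=> v) =
    sigma c p (fcat (fun i => gen_field a (w i) c p) (fun=> v)).
  exact: iota_fieldsE.
have bas w u c p : dom c p -> alpha w c p (fun=> gen_field a u c p) = 0.
  move=> dp; rewrite alphaE.
  by rewrite -(@comp_fcat _ _ (fun u => gen_field a u c p) k 1) basic.
have lin w j s u u' c p v : dom c p -> alpha (upd w j (s *: u + u')) c p (fun=> v) =
    s * alpha (upd w j u) c p (fun=> v) + alpha (upd w j u') c p (fun=> v).
  move=> dp; have E z : fcat (fun i => gen_field a (upd w j z i) c p) (fun _ : 'I_1 => v) =
      upd (fcat (fun i => gen_field a (w i) c p) (fun=> v)) (lshift 1 j)
        (gen_field a z c p).
    rewrite -fcat_updl; congr fcat; exact: (comp_upd (fun u => gen_field a u c p)).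
  have AE z := etrans (alphaE (upd w j z) c p v) (congr1 (sigma c p) (E z)).
  apply: (etrans (AE _)); rewrite (gen_field_linear a s u u' dp).
  apply: (etrans (altform_multilinear (alt c p dp) _ _ s _ _)).
  by congr (_ * _ + _); exact: esym (AE _).
have al w i j c p v : i != j -> w i = w j -> dom c p -> alpha w c p (fun=> v) = 0.
  move=> ij wij dp; rewrite alphaE; have [_ af] := alt c p dp.
  apply: (af _ (lshift 1 i) (lshift 1 j)); first by rewrite eq_lshift.
  by rewrite !fcat_lshift wij.
have [N [nu [oN Np iN H D]]] := local_invariant_primitive cia bas lin al p0.
exists N; split => //; exists nu; split.
- by move=> p /H [].
- by move=> t p /H [_].
- move=> w c; rewrite /smooth_on.
  have oS := @open_image_domI _ _ M c N oN.
  have S x : (coord c @` (dom c `&` N)) x ->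
      differentiable (fun x => nu (param c x) w) x /\
      forall v, 'D_v (fun x => nu (param c x) w) x = alpha w c (param c x) (fun=> v).
    by move=> [p [dp Op'] <-]; have := D w c p Op' dp; rewrite coordK.
  have [_ sma _ _] := cia w.
  (* The derivatives of [nu] are values of a smooth form, so C^j for them gives C^(j+1) for [nu]. *)
  case=> [|j] /=.
    by move=> x /S [d _]; exact: differentiable_continuous d.
  split=> [x /S [] //|v].
  apply: (@eq_Ck _ _ _ _ _ (fun x => alpha w c (param c x) (fun=> v))) => //.
    by move=> x /S [_ ->].
  by apply: Ck_sub (sma c (fun=> v) j) => x [p [dp _] <-]; exact: img_coord.
- move=> W c p v Op' dp.
  have dw w : is_derive (coord c p) v (fun x => nu (param c x) w)
      (alpha w c p (fun=> v)).
    by have [d Dd] := D w c p Op' dp; split; [exact: diff_derivable|exact: Dd].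
  have [_ ->] := is_derive_big_sum W dw.
  by apply: eq_bigr => w _; exact: alphaE.
Qed.

End MultiMoment.

(** * Smoothness and invariance of the form [star phi] *)

Section SmoothAlgebra.
Variables (R : realType) (V : normedModType R) (A : set V) (j : nat).
Hypothesis oA : open A.

Lemma wedge_Ck k l n (F : V -> ('I_k -> 'rV[R]_n) -> R)
    (G : V -> ('I_l -> 'rV[R]_n) -> R) v :
  (forall u, Ck j A (fun x => F x u)) -> (forall u, Ck j A (fun x => G x u)) ->
  Ck j A (fun x => wedge (F x) (G x) v).
Proof.
move=> cF cG; apply: CkM => //; first exact: Ck_cst.
apply: Ck_sum => // s; apply: CkM => //; apply: CkM => //; exact: Ck_cst.
Qed.

Lemma det_Ck N (B : V -> 'M[R]_N) :
  (forall h i, Ck j A (fun x => B x h i)) -> Ck j A (fun x => \det (B x)).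
Proof.
move=> cB; apply: Ck_sum => // s; apply: CkM => //; first exact: Ck_cst.
exact: Ck_prod.
Qed.

(** Cramer's rule: cofactors divided by a determinant without zeros. *)
Lemma invmx_Ck N (B : V -> 'M[R]_N) h i :
  (forall x, A x -> B x \in unitmx) ->
  (forall h i, Ck j A (fun x => B x h i)) -> Ck j A (fun x => invmx (B x) h i).
Proof.
move=> uB cB.
apply: (@eq_Ck _ _ _ _ _ (fun x => (\det (B x))^-1 *
   ((-1) ^+ (i + h) * \det (row' i (col' h (B x)))))) => //.
  by move=> x Ax; rewrite /invmx uB // !mxE.
apply: CkM => //.
  apply: CkV => //; last exact: det_Ck.
  by move=> x Ax; rewrite -unitfE -unitmxE uB.
apply: CkM => //; first exact: Ck_cst.
apply: det_Ck => h' i'; apply: eq_Ck (cB (lift i h') (lift h i')) => // x _.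
by rewrite !mxE.
Qed.

End SmoothAlgebra.

Section StarForm.
Variables (R : realType) (M : manifold R 7) (m : nat) (a : torus_action M m).
Variable phi : preform M 3.
Hypothesis g2 : g2_structure phi.
Hypothesis inv : invariant_form a phi.

Lemma star_altform c p : is_altform (star phi c p).
Proof. exact: (@hodge_altform R 3 4). Qed.

Lemma star_smooth : smooth_form (star phi).
Proof.
have [[alt _ sm] gf] := g2.
move=> c v j; have oI := @img_open _ _ M c; rewrite -/(img c) in oI *.
pose B x := metric_mx (phi c (param c x)).
have cphi u : Ck j (img c) (fun x => phi c (param c x) u) by exact: sm.
have uB x : img c x -> B x \in unitmx.
  by move=> ix; have [dx _] := imgP ix; exact/g2_form_metric_unit/gf.
have cB h i : Ck j (img c) (fun x => B x h i).
  apply: (@eq_Ck _ _ _ _ _ (fun x => 6^-1 * wedge (wedge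
     (contract (bvec R h) (phi c (param c x)))
     (contract (bvec R i) (phi c (param c x)))) (phi c (param c x)) (@bvec R 7))) => //.
    by move=> x _; rewrite mxE.
  apply: CkM => //; first exact: Ck_cst.
  apply: wedge_Ck => // u; apply: wedge_Ck => // u'; exact: cphi.
apply: (@eq_Ck _ _ _ _ _ (fun x => (\det (B x) ^+ 2) `^ (2 / 9) *
   star_sum (invmx (B x)) (phi c (param c x)) v)) => //.
  move=> x ix; have [dx _] := imgP ix; rewrite /star.
  have gx := gf c _ dx; rewrite g2_star_formula //.
  - exact: g2_form_multilinear.
  - exact: uB.
  - exact: g2_metric_exists.
apply: CkM => //.
  (* The sign of \det B depends on the orientation of the chart; its square is positive, where real
     powers are smooth. *)
  apply: Ck_powR => //.
    move=> x ix; rewrite lt0r sqr_ge0 andbT sqrf_eq0 -unitfE -unitmxE; exact: uB.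
  by apply: CkM => //; exact: det_Ck.
apply: CkM => //; first exact: Ck_cst.
apply: Ck_sum => // I; apply: Ck_sum => // J; apply: CkM => //; last exact: Ck_cst.
apply: CkM => //; apply: Ck_prod => // i; exact: invmx_Ck.
Qed.

(** The action of - t read from c' to c is a local inverse, so its Jacobian is the inverse matrix.
    This lets the pointwise naturality of the star apply to the action. *)
Lemma loc_jacobian_unit c c' t p : dom c p -> dom c' (a t p) ->
  exists2 A : 'M[R]_7, A \in unitmx &
    forall v, 'D_v (fun y => loc a c c' (t, y)) (coord c p) = v *m A.
Proof.
move=> dp dq.
pose f y := loc a c c' (t, y); pose g y := loc a c' c (- t, y).
have df := loc_slice_diff (loc_domP dp dq).
have dp' : dom c (a (- t) (a t p)) by rewrite actN.
have dg := loc_slice_diff (loc_domP dq dp').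
have fE : f (coord c p) = coord c' (a t p) by rewrite /f /loc /= coordK.
have df' v : 'D_v f (coord c p) = v *m jacobian f (coord c p).
  exact: deriveEjacobian.
have dg' v : 'D_v g (coord c' (a t p)) = v *m jacobian g (coord c' (a t p)).
  exact: deriveEjacobian.
exists (jacobian f (coord c p)); last exact: df'.
apply: (fun H => (@mulmx1_unit _ _ (jacobian f (coord c p))
  (jacobian g (coord c' (a t p))) H).1).
apply/row_matrixP => i; rewrite row_mul !rowE mulmx1.
rewrite -(df' (delta_mx 0 i)) -dg'.
have dgf : differentiable g (f (coord c p)) by rewrite fE.
have := @derive_comp _ _ _ _ f g (coord c p) (delta_mx 0 i) df dgf.
rewrite fE => <-.
rewrite (@near_eq_derive _ _ _ _ id); first by rewrite derive_id.
have nq : nbhs (param c (coord c p)) (a t @^-1` dom c').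
  by rewrite coordK //; exact: act_cont (dom_nbhs dq).
have := nbhs_param (img_coord dp) nq.
apply: filterS => y [iy dy]; rewrite /= /g /f /loc /= coordK // actN.
by have [] := imgP iy.
Qed.

Lemma star_invariant : invariant_form a (star phi).
Proof.
have [_ gf] := g2.
move=> t c c' p v dp dq; have [A uA AE] := loc_jacobian_unit dp dq.
rewrite /star.
rewrite (_ : (fun i => _) = (fun i => v i *m A)); last first.
  by apply/funext => i; rewrite -AE.
apply/esym; apply: g2_star_comp => //; last exact: gf.
move=> u; rewrite -(inv u dp dq); congr (phi _ _ _).
by apply/funext => i; rewrite -AE.
Qed.

End StarForm.

Theorem mainTheorem8 (R : realType) (M : manifold R 7) (phi : preform M 3)
    (a : torus_action M 3) :
  connected [set: M]%classic ->
  g2_structure phi ->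
  torsion_free phi ->
  effective a ->
  invariant_form a phi ->
  isotropic_orbits phi a ->
  locally_toric phi a.
Proof.
move=> _ g2 [cl cls] _ inv iso p0.
have [[alt _ sm] _] := g2.
have ci : closed_invariant a phi by split.
have cis : closed_invariant a (star phi).
  split; [by move=> c p _; exact: star_altform|exact: star_smooth|
          exact: star_invariant|exact: cls].
have lg c p (dp : dom c p) s (u u' : 'rV[R]_3) := gen_field_linear a s u u' dp.
have [|O1 [oO1 O1p iO1 [nu Hnu]]] := @local_multi_moment_map _ _ M _ a 2 phi p0 ci.
  move=> c p w dp.
  (* Isotropy is given on the standard basis of the Lie algebra; an alternating 3-form on R^3
     vanishing there is zero. *)
  exact: (altform_top_dim w (comp_altform (alt c p dp) (lg c p dp)) (iso c p dp)).
have [|O2 [oO2 O2p iO2 [mu Hmu]]] := @local_multi_moment_map _ _ M _ a 3 (star phi) p0 cis.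
  move=> c p w dp.
  exact: (altform_gt_dim w (comp_altform (star_altform phi c p) (lg c p dp))).
(* The two maps come with different neighbourhoods, and both restrict to the intersection. *)
exists (O1 `&` O2)%classic; split.
- exact: openI.
- by split.
- by move=> t p [h1 h2]; split; [exact: iO1|exact: iO2].
- split; [exists nu|exists mu].
    by apply: multi_moment_mapS Hnu => p [].
  by apply: multi_moment_mapS Hmu => p [].
Qed.
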